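(* With the exception of finitely many pairs $(d,k)$ (where $d\ge 3$ and $1\le k\le d-2$), the following holds: for all integers $n,m\ge 1$, the curves \begin{align*} C_{d,0,n} &= \{ (f,c_1,\ldots,c_1,c_2,\ldots,c_2)\in B^{crit}_{d,k} \;\vert\; c_1 \text{ is periodic with } f^n(c_1)=c_1\},\\ C_{d,1,m} &= \{ (f,c_1,\ldots,c_1,c_2,\ldots,c_2)\in B^{crit}_{d,k} \;\vert\; c_2 \text{ is periodic with } f^m(c_2)=c_2\} \end{align*} intersect transversely in $B^{crit}_{d,k}$.
   Context: Everything is over $\mathbb{C}$, and $f^n$ denotes the $n$-th iterate of $f$. For $d\ge 3$ and $1\le k\le d-2$, $B^{crit}_{d,k}$ is the set of equivalence classes of tuples $(f,c_1,\ldots,c_1,c_2,\ldots,c_2)$ where $f$ is a polynomial of degree $d$ with exactly two (distinct) affine critical points $c_1,c_2$, where $c_1$ occurs $k$ times and $c_2$ occurs $d-1-k$ times, the number of occurrences being the multiplicity of the point as a zero of $f'$. Two tuples are equivalent if they are related by an affine change of variable $\phi$: $f$ is replaced by $\phi^{-1}\circ f\circ\phi$ and $c_i$ by $\phi^{-1}(c_i)$. Coordinates on $B^{crit}_{d,k}$: put $$\mathcal{B}_{d,k}(z)=\sum_{i=0}^{k}\frac{(-1)^{k-i}}{(k-i)!\,i!}\Big(\prod_{0\le j\le k,\ j\ne i}(d-j)\Big)z^{d-i}.$$ This polynomial has affine critical points $0$ (ramification index $d-k$) and $1$ (ramification index $k+1$). Each class has exactly one representative with $c_1=1$ and $c_2=0$,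 and this representative has $f=f_{a,c}$ with $f_{a,c}(z)=a\,\mathcal{B}_{d,k}(z)+c$, $a\neq 0$. Thus $B^{crit}_{d,k}$ is identified with the surface $\{(a,c)\in\mathbb{C}^2: a\ne 0\}$; the curve $C_{d,0,n}$ is defined by the polynomial equation $f^n_{a,c}(1)-1=0$ and $C_{d,1,m}$ by $f^m_{a,c}(0)=0$. The two curves intersect transversely if at each of their points of intersection the Jacobian determinant, with respect to $(a,c)$, of the two polynomials $f^n_{a,c}(1)-1$ and $f^m_{a,c}(0)$ is non-zero. (There may be no point of intersection, in which case the condition is vacuous.) *)

(* Defs.v *)
From mathcomp Require Import all_boot all_order all_algebra.
From mathcomp Require Import classical_sets.
From mathcomp Require Import mpoly.

Set Implicit Arguments.
Unset Strict Implicit.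
Unset Printing Implicit Defensive.

Import GRing.Theory.
Local Open Scope ring_scope.
Local Open Scope classical_set_scope.

(* Since k and d are fixed, the tuple (f, c1, .., c1, c2, .., c2), with k
   copies of c1 and d-1-k copies of c2, is determined by (f, c1, c2). *)
Record marked_poly (F : fieldType) := MarkedPoly {
  mp_poly : {poly F};
  mp_c1 : F;
  mp_c2 : F
}.

Definition crit_tuple (F : fieldType) (d k : nat) (T : marked_poly F) : Prop :=
  [/\ size (mp_poly T) = d.+1,
      mp_c1 T != mp_c2 T,
      forall z, root (mp_poly T)^`() z = (z == mp_c1 T) || (z == mp_c2 T),
      mup (mp_c1 T) (mp_poly T)^`() = k
    & mup (mp_c2 T) (mp_poly T)^`() = (d - 1 - k)%N].

Definition affine (F : fieldType) (u v : F) : {poly F} := u *: 'X + v%:P.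

Definition affine_inv (F : fieldType) (u v : F) : {poly F} :=
  affine u^-1 (- (v / u)).

(* phi^-1 o f o phi, phi^-1(c1), phi^-1(c2), where phi(z) = u z + v *)
Definition conj_affine (F : fieldType) (u v : F) (T : marked_poly F) :
    marked_poly F :=
  MarkedPoly (affine_inv u v \Po (mp_poly T \Po affine u v))
             (affine_inv u v).[mp_c1 T] (affine_inv u v).[mp_c2 T].

Definition affine_equiv (F : fieldType) (T T' : marked_poly F) : Prop :=
  exists u v : F, u != 0 /\ T' = conj_affine u v T.

Definition eq_class (F : fieldType) (T : marked_poly F) : set (marked_poly F) :=
  [set T' | affine_equiv T T'].

Definition Bcrit (F : fieldType) (d k : nat) : set (set (marked_poly F)) :=
  [set X | exists2 T, crit_tuple d k T & X = eq_class T].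

Definition curve_C0 (F : fieldType) (d k n : nat) : set (set (marked_poly F)) :=
  [set X | Bcrit d k X /\ exists2 T, X T &
    iter n (fun z => (mp_poly T).[z]) (mp_c1 T) = mp_c1 T].

Definition curve_C1 (F : fieldType) (d k m : nat) : set (set (marked_poly F)) :=
  [set X | Bcrit d k X /\ exists2 T, X T &
    iter m (fun z => (mp_poly T).[z]) (mp_c2 T) = mp_c2 T].

Definition Bpoly (F : fieldType) (d k : nat) : {poly F} :=
  \sum_(i < k.+1)
    ((-1) ^+ (k - i) / ((k - i)`! * i`!)%:R
       * \prod_(j < k.+1 | j != i) (d - j)%:R) *: 'X^(d - i).

(* the point of the moduli space with coordinates (a, c) *)
Definition chart (F : fieldType) (d k : nat) (a c : F) : set (marked_poly F) :=
  eq_class (MarkedPoly (a *: Bpoly F d k + c%:P) 1 0).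

Definition var_a (F : fieldType) : {mpoly F[2]} := 'X_0.
Definition var_c (F : fieldType) : {mpoly F[2]} := 'X_1.

(* f_{a,c}(z) with the parameters a, c kept as indeterminates *)
Definition univ_map (F : fieldType) (d k : nat) (z : {mpoly F[2]}) :
    {mpoly F[2]} :=
  var_a F * (map_poly (@mpolyC 2 F) (Bpoly F d k)).[z] + var_c F.

(* the equations f_{a,c}^n(1) - 1 and f_{a,c}^m(0), as polynomials in a, c *)
Definition eq_C0 (F : fieldType) (d k n : nat) : {mpoly F[2]} :=
  iter n (univ_map d k) 1 - 1.

Definition eq_C1 (F : fieldType) (d k m : nat) : {mpoly F[2]} :=
  iter m (univ_map d k) 0.

Definition jacobian_det (F : fieldType) (p q : {mpoly F[2]}) (a c : F) : F :=
  \det (\matrix_(i < 2, j < 2)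
    ((if i == 0 then p else q)^`M(j)).@[fun l : 'I_2 => if l == 0 then a else c]).

Definition intersect_transversely (F : fieldType) (d k n m : nat) : Prop :=
  forall X : set (marked_poly F),
    curve_C0 d k n X -> curve_C1 d k m X ->
    exists a c : F,
      [/\ a != 0,
          X = chart d k a c
        & jacobian_det (eq_C0 F d k n) (eq_C1 F d k m) a c != 0].

(* Main.v *)
Require Import Defs.
From mathcomp Require Import all_boot all_order all_algebra.
From mathcomp Require Import reals.
From mathcomp.real_closed Require Import complex.
From mathcomp Require Import -(notations) mpoly.
From mathcomp Require Import classical_sets boolp ereal.
From mathcomp Require Import measure lebesgue_measure lebesgue_integral.
From mathcomp Require Import zify ring lra.

Set Implicit Arguments.
Unset Strict Implicit.
Unset Printing Implicit Defensive.

Import Order.TTheory GRing.Theory Num.Theory.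
Local Open Scope ring_scope.

(** The two curves meet transversely for every pair (d, k), so the list of
    exceptional pairs can be taken empty. The reason is infinitesimal rigidity
    of postcritically finite maps, proved with quadratic differentials.

    Let [f = a B + c] with both critical points 1 and 0 periodic,
    [f^n(1) = 1] and [f^m(0) = 0]. If the Jacobian vanishes, some nontrivial
    combination, with coefficients [lam] and [mu], of the differentials of
    [f^n(1)] and [f^m(0)] with respect to (a, c) is zero. Differentiating the
    recursion [x_(i+1) = f(x_i)] writes this combination as a sum over the
    critical orbits in which a point [x] gets a weight [gamma_x], a product of
    values of [f'] along the rest of the orbit; its vanishing says that
    [sum gamma_x = 0] and [sum gamma_x x = 0]. Consider
    [q(z) = sum gamma_x / (z - x)], the coefficient of a meromorphic quadratic
    differential [q(z) dz^2].

    The weights satisfy [gamma_x = f'(x) gamma_(f(x))] away from the critical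
    points, which, with the two vanishing moments, makes [q] invariant under
    push-forward ([quad_pushforward]): [q(z)] is the sum of [q(u) / f'(u)^2]
    over the solutions [u] of [f(u) = z]. An invariant [q] must vanish, by an area
    argument. On the set of points that escape to infinity [q] is bounded,
    because its poles lie on superattracting cycles, whose neighbourhoods never
    escape ([separated_cycle]). If [q] were nonzero at some [z] near infinity,
    invariance under the iterates [f^N] would bound the sum of
    [1 / |(f^N)'(w)|^2] over [f^N(w) = z] from below, uniformly in [N] and in
    [z] ranging over a small disk. This sum is the density of the area of the
    preimage of the disk under [f^N]; so all these preimages would have area
    bounded below, although they are pairwise disjoint and stay in a bounded
    region ([no_invariant_density]). Hence [q = 0], while its residues at 1 and
    0 are [lam] and [mu] ([critical_rigidity]): a contradiction.

    The remaining ingredients are the normal form [a B + c] of a class, which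
    follows from the factorization of [B'], and the invariance of periodicity
    under affine conjugation. *)

Local Notation it f n x := (iter n (fun z => f.[z]) x).

(** * Push-forward of the quadratic differential carried by the critical orbits *)

Section Push.
Variable F : fieldType.
Implicit Types (f g p V : {poly F}) (h : F -> F).

Lemma horner_divp_XsubC g u w :
  root g u -> g.[w] = (g %/ ('X - u%:P)).[w] * (w - u).
Proof.
by rewrite -dvdp_XsubCl => /divpK {1}<-; rewrite hornerM hornerXsubC.
Qed.

Lemma horner_divp_deriv g u :
  root g u -> (g %/ ('X - u%:P)).[u] = g^`().[u].
Proof.
rewrite -dvdp_XsubCl => /divpK {2}<-.
by rewrite derivM !hornerE derivXsubC !hornerE subrr mulr0 add0r.
Qed.

(** Euclidean division leaves a remainder of degree less than [deg g], and
    Lagrange interpolation at the simple roots of [g] recovers that remainder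
    from the values of [V]. The numerator may exceed [g] by one degree, hence
    a quotient [J] of degree at most 1: exactly the functions that the sums
    over critical orbits kill later on. *)
Lemma partial_fraction g V us :
    uniq us -> all (root g) us -> (size us).+1 = size g ->
    {in us, forall u, g^`().[u] != 0} ->
    (size V <= (size g).+1)%N ->
  exists J : {poly F}, (size J <= 2)%N /\
    forall w, g.[w] != 0 ->
      V.[w] / g.[w] = J.[w] + \sum_(u <- us) V.[u] / (g^`().[u] * (w - u)).
Proof.
move=> uus rus sz dg szV.
have g0 : g != 0 by rewrite -size_poly_gt0 -sz.
exists (V %/ g); split.
  by rewrite size_divp //; case: (size g) sz szV => //= k _ ?; rewrite leq_subLR addn2.
move=> w gw.
(* The Lagrange interpolant of [V] at the roots of [g]. *)
pose T := \sum_(u <- us) (V.[u] / g^`().[u]) *: (g %/ ('X - u%:P)).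
have szT : (size T <= size us)%N.
  rewrite /T big_seq; apply: (leq_trans (size_sum _ _ _)).
  apply/bigmax_leqP_seq => u uin _; apply: (leq_trans (size_scale_leq _ _)).
  by rewrite size_divp ?polyXsubC_eq0 // size_XsubC -sz subn1.
have ET : V %% g = T.
  apply/eqP; rewrite -subr_eq0; apply/eqP.
  apply: (@roots_geq_poly_eq0 _ _ us) => //; last first.
    rewrite (leq_trans (size_polyD _ _)) // geq_max size_polyN szT andbT.
    by rewrite -ltnS sz ltn_modp.
  apply/allP => v vin; rewrite rootE hornerD hornerN.
  have rv := allP rus v vin.
  have -> : (V %% g).[v] = V.[v].
    by rewrite {2}(divp_eq V g) hornerD hornerM (rootP rv) mulr0 add0r.
  rewrite horner_sum (bigD1_seq v) //= hornerZ horner_divp_deriv //.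
  rewrite mulfVK ?dg // big1_seq ?addr0 ?subrr // => u /andP[uv uin].
  rewrite hornerZ.
  have := horner_divp_XsubC v (allP rus u uin).
  rewrite (rootP rv) => /esym/eqP; rewrite mulf_eq0 [v - u == 0]subr_eq0.
  by rewrite [v == u]eq_sym (negPf uv) orbF => /eqP ->; rewrite mulr0.
rewrite {1}(divp_eq V g) hornerD hornerM mulrDl mulfK //; congr (_ + _).
rewrite ET horner_sum mulr_suml big_seq [RHS]big_seq; apply: eq_bigr => u uin.
have ru := allP rus u uin.
have E := horner_divp_XsubC w ru.
have wu : w - u != 0 by apply: contraNneq gw => wu; rewrite E wu mulr0.
have gu : (g %/ ('X - u%:P)).[w] != 0.
  by apply: contraNneq gw => wu0; rewrite E wu0 mul0r.
rewrite hornerZ E; field.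
by rewrite wu gu dg.
Qed.

(** The solution of the variational recursion [v' = h(f(x)) + f'(x) v] along
    an orbit, starting from [v = 0]. Expanded, it is the sum of [h] over the
    points of the orbit after [x], each with the derivative of the iterate of
    [f] leading from that point to the last one. *)
Fixpoint orbit_sum f x n h : F :=
  if n is n'.+1 then h (it f n'.+1 x) + f^`().[it f n' x] * orbit_sum f x n' h
  else 0.

Lemma orbit_sumS f x n h :
  orbit_sum f x n.+1 h = h (it f n.+1 x) + f^`().[it f n x] * orbit_sum f x n h.
Proof. by []. Qed.

Lemma eq_orbit_sum f x n h1 h2 :
  (forall i, h1 (it f i.+1 x) = h2 (it f i.+1 x)) ->
  orbit_sum f x n h1 = orbit_sum f x n h2.
Proof. by move=> e; elim: n => //= n ->; rewrite (e n). Qed.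

Lemma orbit_sumD f x n h1 h2 :
  orbit_sum f x n (fun z => h1 z + h2 z) =
  orbit_sum f x n h1 + orbit_sum f x n h2.
Proof. by elim: n => /= [|n ->]; rewrite ?addr0 // mulrDr addrACA. Qed.

Lemma orbit_sumZ f x n a h :
  orbit_sum f x n (fun z => a * h z) = a * orbit_sum f x n h.
Proof. by elim: n => /= [|n ->]; rewrite ?mulr0 // mulrDr mulrCA. Qed.

(** The weight of a point is [f'] times the weight of its image. So a factor
    [V] can be traded against the image point as soon as [V f'] factors
    through [f]; the two sides then telescope, up to a boundary term at each
    end of the orbit. *)
Lemma orbit_sum_shift f x n V h k :
    (forall w, V.[w] * f^`().[w] * h f.[w] = k f.[w]) ->
    k f.[x] = 0 ->
  orbit_sum f x n.+1 (fun w => V.[w] * h f.[w]) =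
    orbit_sum f x n.+1 k + V.[it f n.+1 x] * h (it f n.+2 x).
Proof.
move=> hk k0; elim: n => [|n IH]; first by rewrite /= !mulr0 !addr0 k0 add0r.
rewrite orbit_sumS IH (orbit_sumS _ _ n.+1) !iterS -hk; ring.
Qed.

Lemma orbit_sum_pullback f x n V h k :
    (0 < n)%N -> it f n x = x -> V.[x] = 0 ->
    (forall w, V.[w] * f^`().[w] * h f.[w] = k f.[w]) ->
    k f.[x] = 0 ->
  orbit_sum f x n (fun w => V.[w] * h f.[w]) = orbit_sum f x n k.
Proof.
case: n => // n _ xn Vx hk k0.
by rewrite (orbit_sum_shift n hk k0) xn Vx mul0r addr0.
Qed.

(** If [h] is supported on the zeros of [f'], the weight of every point but
    the last vanishes whenever [h] does not. This isolates residues at the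
    critical points. *)
Lemma orbit_sum_last f x n h :
    (0 < n)%N -> (forall w, f^`().[w] * h w = 0) ->
  orbit_sum f x n h = h (it f n x).
Proof.
case: n => // n _ hh /=; set y := iter n _ x.
suff -> : f^`().[y] * orbit_sum f x n h = 0 by rewrite addr0.
rewrite {}/y; elim: n => [|n IH]; first by rewrite mulr0.
by rewrite [orbit_sum _ _ _ _]/= IH addr0 hh.
Qed.

End Push.

Section Pushforward.
Variables (F : fieldType) (f V : {poly F}) (n m : nat) (lam mu : F).
Hypotheses (n0 : (0 < n)%N) (m0 : (0 < m)%N).
Hypotheses (fn1 : it f n 1 = 1) (fm0 : it f m 0 = 0).
Hypothesis VE : V * f^`() = (f - (f.[0])%:P) * (f - (f.[1])%:P).
Hypotheses (V0 : V.[0] = 0) (V1 : V.[1] = 0).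
Hypothesis szV : (size V <= (size f).+1)%N.
Hypothesis szf : (1 < size f)%N.

(** The linear functional on functions that is carried by the two critical
    orbits. With [lam] and [mu] in the kernel of the transposed Jacobian it
    kills all affine functions. *)
Definition pc_sum h := lam * orbit_sum f 1 n h + mu * orbit_sum f 0 m h.

Definition off_orbits z := forall i, it f i 1 != z /\ it f i 0 != z.

(** The coefficient [q] of the quadratic differential [q(z) dz^2]. *)
Definition quad z := pc_sum (fun x => (z - x)^-1).

Hypothesis sum1 : pc_sum (fun=> 1) = 0.
Hypothesis sumX : pc_sum (fun x => x) = 0.

Lemma eq_pc_sum h1 h2 :
  (forall i, h1 (it f i.+1 1) = h2 (it f i.+1 1)) ->
  (forall i, h1 (it f i.+1 0) = h2 (it f i.+1 0)) ->
  pc_sum h1 = pc_sum h2.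
Proof.
by move=> e1 e0; rewrite /pc_sum (eq_orbit_sum _ e1) (eq_orbit_sum _ e0).
Qed.

Lemma pc_sumD h1 h2 : pc_sum (fun z => h1 z + h2 z) = pc_sum h1 + pc_sum h2.
Proof. by rewrite /pc_sum !orbit_sumD !mulrDr addrACA. Qed.

Lemma pc_sumZ a h : pc_sum (fun z => a * h z) = a * pc_sum h.
Proof. by rewrite /pc_sum !orbit_sumZ mulrDr !(mulrCA a). Qed.

Lemma pc_sum_big (I : Type) (s : seq I) (h : I -> F -> F) :
  pc_sum (fun z => \sum_(i <- s) h i z) = \sum_(i <- s) pc_sum (h i).
Proof.
elim: s => [|i s IH].
  rewrite big_nil -[RHS](mul0r (pc_sum (fun=> 0))) -pc_sumZ.
  by apply: eq_pc_sum => j; rewrite big_nil mul0r.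
by rewrite big_cons -IH -pc_sumD; apply: eq_pc_sum => j; rewrite big_cons.
Qed.

Lemma pc_sum_affine (J : {poly F}) : (size J <= 2)%N -> pc_sum (horner J) = 0.
Proof.
move=> sJ; transitivity (pc_sum (fun x => J`_0 * 1 + J`_1 * x)).
  by apply: eq_pc_sum => j; rewrite (horner_coef_wide _ sJ) !big_ord_recl big_ord0 /=
    addr0 expr0 expr1.
by rewrite pc_sumD !pc_sumZ sum1 sumX !mulr0 addr0.
Qed.

(** Here [V = (f - f(0)) (f - f(1)) / f'] is a polynomial, because [f - f(c)]
    vanishes at a critical point [c] to one order more than [f'] does. Since
    [V(u) / f'(u) = (z - f(0)) (z - f(1)) / f'(u)^2] when [f(u) = z], the
    partial fractions of [V / (f - z)] have the coefficients of the
    push-forward. Apply the functional [pc_sum] to [V / (f - z)] in two ways: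
    by partial fractions it gives the push-forward of [q]; by the transfer of
    [V] to image points it gives the sum of
    [(X - f(0)) (X - f(1)) / (X - z)], which is a multiple of [1 / (X - z)]
    modulo affine functions, that is, [q(z)]. The common factor is
    [-(z - f(0)) (z - f(1))]. *)
Theorem quad_pushforward z us :
    off_orbits z ->
    uniq us -> (forall u, u \in us -> f.[u] = z) -> (size us).+1 = size f ->
    {in us, forall u, f^`().[u] != 0} ->
  quad z = \sum_(u <- us) quad u / f^`().[u] ^+ 2.
Proof.
move=> zoff uus fus szus dus.
pose g := f - z%:P.
have dg : g^`() = f^`() by rewrite derivB derivC subr0.
have szg : size g = size f.
  by rewrite size_polyDl // size_polyN size_polyC; case: (_ != _) => //=; apply: ltn_trans szf.
have gE w : g.[w] = f.[w] - z by rewrite !hornerE.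
have rus : all (root g) us.
  by apply/allP => u /fus fu; rewrite rootE gE fu subrr.
have gus : {in us, forall u, g^`().[u] != 0} by move=> u uin; rewrite dg dus.
have [J [sJ JE]] : exists J : {poly F}, (size J <= 2)%N /\
    forall w, g.[w] != 0 ->
      V.[w] / g.[w] = J.[w] + \sum_(u <- us) V.[u] / (g^`().[u] * (w - u)).
  by apply: partial_fraction => //; rewrite szg.
set x1 := f.[1]; set y1 := f.[0].
have zx : z - x1 != 0 by rewrite subr_eq0 eq_sym; case: (zoff 1).
have zy : z - y1 != 0 by rewrite subr_eq0 eq_sym; case: (zoff 1).
have VEw w : V.[w] * f^`().[w] = (f.[w] - y1) * (f.[w] - x1).
  by rewrite -hornerM VE hornerM !hornerD !hornerN !hornerC.
have off x : (forall i, it f i x != z) -> forall i,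
    (it f i.+1 x - z != 0) /\ g.[it f i.+1 x] != 0
     /\ forall u, u \in us -> it f i.+1 x - u != 0.
  move=> zo i; split; [|split]; rewrite ?gE ?subr_eq0 //.
    by have := zo i.+2; rewrite iterS.
  move=> u /fus fu; rewrite subr_eq0; apply: contra_neq (zo i.+2) => /= ->.
  exact: fu.
have pull : pc_sum (fun w => V.[w] / (f.[w] - z)) =
    pc_sum (fun X => (X - y1) * (X - x1) / (X - z)).
  by rewrite /pc_sum (@orbit_sum_pullback _ f 1 n V (fun X => (X - z)^-1)
     (fun X => (X - y1) * (X - x1) / (X - z)))
     ?(@orbit_sum_pullback _ f 0 m V (fun X => (X - z)^-1)
     (fun X => (X - y1) * (X - x1) / (X - z))) //
     ?subrr ?mulr0 ?mul0r // => w; rewrite VEw.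
have e1 : pc_sum (fun X => (X - y1) * (X - x1) / (X - z)) =
    - ((z - y1) * (z - x1)) * quad z.
  transitivity (pc_sum (fun X => (- ((z - y1) * (z - x1))) * (z - X)^-1
      + ('X + (z - x1 - y1)%:P).[X])).
    have dec X : X - z != 0 -> (X - y1) * (X - x1) / (X - z) =
       (- ((z - y1) * (z - x1))) * (z - X)^-1 + ('X + (z - x1 - y1)%:P).[X].
      move=> Xz; rewrite hornerD hornerX hornerC; field.
      by rewrite Xz -opprB oppr_eq0 Xz.
    by apply: eq_pc_sum => i; apply: dec;
      [case: (off 1 (fun i => proj1 (zoff i)) i)
      |case: (off 0 (fun i => proj2 (zoff i)) i)].
  by rewrite pc_sumD pc_sumZ pc_sum_affine ?addr0 // size_XaddC.
have e2 : pc_sum (fun w => V.[w] / (f.[w] - z)) =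
    - ((z - y1) * (z - x1)) * \sum_(u <- us) quad u / f^`().[u] ^+ 2.
  transitivity (pc_sum (fun w => J.[w] + \sum_(u <- us)
      (- ((z - y1) * (z - x1)) / f^`().[u] ^+ 2) * (u - w)^-1)).
    have dec w : g.[w] != 0 -> (forall u, u \in us -> w - u != 0) ->
        V.[w] / (f.[w] - z) = J.[w] + \sum_(u <- us)
          (- ((z - y1) * (z - x1)) / f^`().[u] ^+ 2) * (u - w)^-1.
      move=> gw wu; rewrite -gE JE //; congr (_ + _).
      rewrite big_seq [RHS]big_seq; apply: eq_bigr => u uin.
      have := VEw u; rewrite (fus _ uin) => VU.
      have := dus u uin; have := wu u uin => wu0 du0.
      rewrite dg -VU; field.
      by rewrite du0 wu0 -opprB oppr_eq0 wu0.
    apply: eq_pc_sum => i; first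
      by case: (off 1 (fun i => proj1 (zoff i)) i) => _ []; exact: dec.
    by case: (off 0 (fun i => proj2 (zoff i)) i) => _ []; exact: dec.
  rewrite pc_sumD (pc_sum_affine sJ) add0r pc_sum_big mulr_sumr.
  apply: eq_bigr => u _; rewrite pc_sumZ -/(quad u); ring.
have c0 : - ((z - y1) * (z - x1)) != 0 by rewrite oppr_eq0 mulf_neq0.
by apply: (mulfI c0); rewrite -e1 -e2 pull.
Qed.

End Pushforward.

(** * Modulus of complex numbers and packing of disks *)

Section Modulus.
Variable R : rcfType.
Local Notation C := R[i]%C.

Definition cmod (z : C) : R := Normc.normc z.

Lemma normrE (z : C) : `|z| = (cmod z)%:C%C. Proof. by []. Qed.

Lemma cmod_ge0 z : 0 <= cmod z. Proof. by case: z => a b; exact: sqrtr_ge0. Qed.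

Lemma cmod0 : cmod 0 = 0. Proof. exact: Normc.normc0. Qed.

Lemma cmod1 : cmod 1 = 1. Proof. exact: Normc.normc1. Qed.

Lemma cmod_eq0 z : (cmod z == 0) = (z == 0).
Proof.
by apply/eqP/eqP => [/Normc.eq0_normc//|->]; exact: cmod0.
Qed.

Lemma cmod_gt0 z : (0 < cmod z) = (z != 0).
Proof. by rewrite lt_neqAle cmod_ge0 andbT eq_sym cmod_eq0. Qed.

Lemma cmodM y z : cmod (y * z) = cmod y * cmod z.
Proof. exact: Normc.normcM. Qed.

Lemma cmodV z : cmod z^-1 = (cmod z)^-1.
Proof. exact: Normc.normcV. Qed.

Lemma cmodX z n : cmod (z ^+ n) = cmod z ^+ n.
Proof. by elim: n => [|n IH]; rewrite ?cmod1 // !exprS cmodM IH. Qed.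

Lemma cmodN z : cmod (- z) = cmod z.
Proof. by case: z => a b; rewrite /cmod /= !sqrrN. Qed.

Lemma cmodD y z : cmod (y + z) <= cmod y + cmod z.
Proof.
by rewrite -lecR rmorphD /= -!normrE; exact: ler_normD.
Qed.

Lemma cmodBC y z : cmod (y - z) = cmod (z - y).
Proof. by rewrite -cmodN opprB. Qed.

Lemma cmod_triangle y z t : cmod (y - z) <= cmod (y - t) + cmod (t - z).
Proof. by have := cmodD (y - t) (t - z); rewrite addrA subrK. Qed.

Lemma cmodB_ge y z : cmod y - cmod z <= cmod (y - z).
Proof. by rewrite lerBlDr; have := cmodD (y - z) z; rewrite subrK. Qed.

Lemma cmod_sum (I : Type) (s : seq I) (h : I -> C) :
  cmod (\sum_(i <- s) h i) <= \sum_(i <- s) cmod (h i).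
Proof.
elim: s => [|i s IH]; first by rewrite !big_nil cmod0.
by rewrite !big_cons (le_trans (cmodD _ _)) // lerD2l.
Qed.

Lemma cmod_real (a : R) : cmod a%:C%C = `|a|.
Proof. by rewrite /cmod /= expr0n addr0 sqrtr_sqr. Qed.

Lemma cmod_nat n : cmod n%:R = n%:R.
Proof. by rewrite -(rmorph_nat (real_complex R)) cmod_real normr_nat. Qed.

Lemma cmod_rect (a b : R) : cmod (a +i* b)%C <= `|a| + `|b|.
Proof.
rewrite -(@ler_sqr R) ?nnegrE ?cmod_ge0 ?addr_ge0 // /cmod /=.
rewrite sqr_sqrtr ?addr_ge0 ?sqr_ge0 // sqrrD !real_normK ?num_real //.
rewrite -addrA lerD2l lerDr mulrn_wge0 // mulr_ge0 //.
Qed.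

Lemma cmod_rectB (a b : R) (w : C) :
  cmod ((a +i* b)%C - w) <= `|a - complex.Re w| + `|b - complex.Im w|.
Proof. by case: w => c d; exact: cmod_rect. Qed.

Lemma Re_le_cmod (z : C) : `|complex.Re z| <= cmod z.
Proof.
case: z => a b /=; rewrite /cmod /= -sqrtr_sqr ler_wsqrtr //.
by rewrite lerDl sqr_ge0.
Qed.

Lemma Im_le_cmod (z : C) : `|complex.Im z| <= cmod z.
Proof.
case: z => a b /=; rewrite /cmod /= -sqrtr_sqr ler_wsqrtr //.
by rewrite lerDr sqr_ge0.
Qed.

End Modulus.

Section Packing.
Local Open Scope classical_set_scope.
Variable R : realType.
Local Notation C := R[i]%C.

Let plane := (measurableTypeR R * measurableTypeR R)%type.
Let mu : {measure set plane -> \bar R} := (@lebesgue_measure R \x @lebesgue_measure R)%E.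

Definition square (w : C) (r : R) : set plane :=
  `[complex.Re w - r, complex.Re w + r] `*` `[complex.Im w - r, complex.Im w + r].

Lemma measurable_square w r : measurable (square w r).
Proof. by apply: measurableX; exact: measurable_itv. Qed.

Lemma area_square w r : 0 <= r -> mu (square w r) = ((2 * r) ^+ 2)%:E.
Proof.
move=> r0; rewrite [LHS]product_measure1E; try exact: measurable_itv.
have side (a : R) : lebesgue_measure `[a - r, a + r] = (2 * r)%:E.
  rewrite lebesgue_measure_itv /= lte_fin.
  case: ltP => h; first by rewrite -EFinD; congr EFin; lra.
  by congr EFin; lra.
by rewrite [X in (X * _)%E]side [X in (_ * X)%E]side -EFinM expr2.
Qed.

(** Compare Lebesgue measures in the plane. Each disk contains a concentric
    square of side its radius [r i], hence of area [r i ^+ 2]; these squares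
    are disjoint and lie in the square of side [2 * rho] around the origin. *)
Theorem disk_packing (T : eqType) (s : seq T) (w : T -> C) (r : T -> R) (rho : R) :
    uniq s -> 0 <= rho ->
    (forall i, i \in s -> 0 <= r i /\ cmod (w i) + r i <= rho) ->
    (forall i j u, i \in s -> j \in s -> i != j ->
       cmod (u - w i) <= r i -> cmod (u - w j) <= r j -> False) ->
  \sum_(i <- s) r i ^+ 2 <= 4 * rho ^+ 2.
Proof.
move=> us rho0 rs dis.
pose Sq i := square (w i) (r i / 2).
have inSq i (p : plane) : i \in s -> Sq i p -> cmod ((p.1 +i* p.2)%C - w i) <= r i.
  move=> /rs[ri0 _] [/=]; rewrite !in_itv /= => /andP[a1 a2] /andP[b1 b2].
  apply: le_trans (cmod_rectB _ _ _) _.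
  have -> : r i = r i / 2 + r i / 2 by lra.
  by apply: lerD; rewrite ler_norml; lra.
have sub i : i \in s -> Sq i `<=` square 0 rho.
  move=> si p ip; have h := inSq i p si ip; have [ri0 hr] := rs i si.
  have hp : cmod (p.1 +i* p.2)%C <= rho.
    have := cmodD ((p.1 +i* p.2)%C - w i) (w i); rewrite subrK; lra.
  have := le_trans (Re_le_cmod _) hp; have := le_trans (Im_le_cmod _) hp.
  rewrite /= !ler_norml => /andP[? ?] /andP[? ?].
  by split; rewrite /= in_itv /=; apply/andP; split; lra.
have key : forall t, uniq t -> {subset t <= s} ->
  [/\ measurable (\big[setU/set0]_(i <- t) Sq i),
    mu (\big[setU/set0]_(i <- t) Sq i) = (\sum_(i <- t) r i ^+ 2)%:E,
    \big[setU/set0]_(i <- t) Sq i `<=` square 0 rho &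
    (forall p, (\big[setU/set0]_(i <- t) Sq i) p -> exists2 i, i \in t & Sq i p)].
  elim=> [_ _|i t IH /= /andP[it ut] ts].
    by rewrite !big_nil measure0; split.
  have [|mt at_ st ex] := IH ut; first by move=> j jt; rewrite ts // inE jt orbT.
  have si : i \in s by rewrite ts // inE eqxx.
  have mi : measurable (Sq i) by exact: measurable_square.
  rewrite !big_cons; split.
  - exact: measurableU.
  - rewrite measureU //; last first.
      apply/seteqP; split => // p [ip /ex[j jt jp]].
      apply: (dis i j (p.1 +i* p.2)%C) => //; first by rewrite ts // inE jt orbT.
      - by apply: contraNneq it => ->.
      - exact: inSq.
      - by apply: inSq => //; rewrite ts // inE jt orbT.
    rewrite EFinD; congr (_ + _)%E; last exact: at_.
    rewrite [LHS]area_square; last by case: (rs i si) => ? _; lra.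
    by congr EFin; field.
  - by move=> p [/(sub i si)//|/st].
  - move=> p [ip|/ex[j jt jp]]; first by exists i; rewrite ?inE ?eqxx.
    by exists j => //; rewrite inE jt orbT.
have [|ms a_s ss _] := key s us; first by [].
rewrite -lee_fin -[leLHS]a_s.
have -> : (4 * rho ^+ 2)%:E = mu (square 0 rho).
  by rewrite area_square //; congr EFin; ring.
apply: le_measure; rewrite ?inE //; exact: measurable_square.
Qed.

End Packing.

(** * Escaping points of a complex polynomial *)

Section PolyBounds.
Variable R : rcfType.
Local Notation C := R[i]%C.
Implicit Types (p f : {poly C}) (z w u : C).

Lemma poly_bounded p (rho : R) :
  exists2 B : R, 0 <= B & forall z, cmod z <= rho -> cmod p.[z] <= B.
Proof.
elim/poly_ind: p => [|p c [B B0 HB]].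
  by exists 0 => // z _; rewrite horner0 cmod0.
exists (B * `|rho| + cmod c); first by rewrite addr_ge0 ?mulr_ge0 ?cmod_ge0.
move=> z hz; rewrite hornerMXaddC (le_trans (cmodD _ _)) // lerD2r cmodM.
by rewrite ler_pM ?cmod_ge0 ?HB // (le_trans hz) // ler_norm.
Qed.

(** The error [E] of the first-order expansion satisfies, for [p X + c],
    [E(p X + c) = E(p) u + p'(w) (u - w)^2]. *)
Lemma poly_taylor p (rho : R) :
  exists2 B : R, 0 <= B & forall u w, cmod u <= rho -> cmod w <= rho ->
    cmod (p.[u] - p.[w] - p^`().[w] * (u - w)) <= B * cmod (u - w) ^+ 2.
Proof.
elim/poly_ind: p => [|p c [B B0 HB]].
  by exists 0 => // u w _ _; rewrite deriv0 !horner0 !(mul0r, subr0) cmod0.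
have [B' B'0 HB'] := poly_bounded p^`() rho.
exists (B * `|rho| + B'); first by rewrite addr_ge0 ?mulr_ge0.
move=> u w hu hw; rewrite derivMXaddC !hornerMXaddC hornerD hornerMX.
have -> : p.[u] * u + c - (p.[w] * w + c) - (p.[w] + p^`().[w] * w) * (u - w) =
  (p.[u] - p.[w] - p^`().[w] * (u - w)) * u + p^`().[w] * (u - w) ^+ 2 by ring.
rewrite (le_trans (cmodD _ _)) // [leRHS]mulrDl lerD // cmodM ?cmodX.
  rewrite mulrAC ler_pM ?cmod_ge0 ?HB //.
  by rewrite (le_trans hu) // ler_norm.
by rewrite ler_wpM2r ?exprn_ge0 ?cmod_ge0 ?HB'.
Qed.

Lemma poly_lipschitz p (rho : R) :
  exists2 B : R, 0 <= B & forall u w, cmod u <= rho -> cmod w <= rho ->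
    cmod (p.[u] - p.[w]) <= B * cmod (u - w).
Proof.
elim/poly_ind: p => [|p c [B B0 HB]].
  by exists 0 => // u w _ _; rewrite !horner0 subr0 cmod0 mul0r.
have [B' B'0 HB'] := poly_bounded p rho.
exists (B * `|rho| + B'); first by rewrite addr_ge0 ?mulr_ge0.
move=> u w hu hw; rewrite !hornerMXaddC.
have -> : p.[u] * u + c - (p.[w] * w + c) =
  (p.[u] - p.[w]) * u + p.[w] * (u - w) by ring.
rewrite (le_trans (cmodD _ _)) // [leRHS]mulrDl lerD // cmodM.
  rewrite mulrAC ler_pM ?cmod_ge0 ?HB //.
  by rewrite (le_trans hu) // ler_norm.
by rewrite ler_wpM2r ?cmod_ge0 ?HB'.
Qed.

Lemma poly_large p (M : R) : (1 < size p)%N ->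
  exists r : R, forall z, r <= cmod z -> M <= cmod p.[z].
Proof.
elim/poly_ind: p M => [|p c IH] M; first by rewrite size_poly0.
rewrite size_MXaddC; case: ifP => // /negbT; rewrite negb_and => pc.
case: (ltnP 1 (size p)) => [sp _|sp].
  have [r Hr] := IH (`|M| + cmod c) sp.
  exists (Num.max r 1) => z; rewrite ge_max => /andP[rz z1].
  have := Hr z rz; have := cmodB_ge (p.[z] * z) (- c).
  rewrite opprK hornerMXaddC cmodN cmodM => h1 h2.
  have h3 : cmod p.[z] <= cmod p.[z] * cmod z by rewrite ler_peMr ?cmod_ge0.
  have := ler_norm M; lra.
have {sp} sp : size p = (size p != 0)%N by move: sp; case: (size p) => [|[]].
rewrite ltnS sp; case: eqP => // /eqP p0 _.
have [a a0 pa] : exists2 a : C, a != 0 & p = a%:P.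
  exists p`_0; last by apply: size1_polyC; rewrite sp p0.
  by move: p0; rewrite size_poly_eq0; apply: contra => /eqP h;
    rewrite (size1_polyC (p := p)) ?h // sp leq_b1.
have ga : 0 < cmod a by rewrite cmod_gt0.
exists ((`|M| + cmod c) / cmod a) => z; rewrite ler_pdivrMr // => h.
have := cmodB_ge (p.[z] * z) (- c).
rewrite opprK hornerMXaddC cmodN cmodM pa hornerC => h1.
have := ler_norm M; rewrite mulrC in h; lra.
Qed.

Lemma escape_radius f : (2 < size f)%N ->
  exists2 r : R, 1 <= r & forall z, r <= cmod z -> 2 * cmod z <= cmod f.[z].
Proof.
elim/poly_ind: f => [|p c _]; first by rewrite size_poly0.
rewrite size_MXaddC; case: ifP => // _; rewrite ltnS => sp.
have [r Hr] := poly_large (2 + cmod c) sp.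
exists (Num.max r 1); first by rewrite le_max lexx orbT.
move=> z; rewrite ge_max => /andP[rz z1].
have := cmodB_ge (p.[z] * z) (- c).
rewrite opprK hornerMXaddC cmodN cmodM => h1.
have h2 : (2 + cmod c) * cmod z <= cmod p.[z] * cmod z.
  by rewrite ler_wpM2r ?cmod_ge0 ?Hr.
have h3 : cmod c <= cmod c * cmod z by rewrite ler_peMr ?cmod_ge0.
lra.
Qed.

End PolyBounds.

Section Iterates.
Variables (F : fieldType) (f : {poly F}).

(** The iterate of [f] as a polynomial. Composing on the right makes the chain
    rule split off the derivative at the first point of the orbit. *)
Definition iterp N : {poly F} := iter N (fun p => p \Po f) 'X.

Lemma horner_iterp N z : (iterp N).[z] = it f N z.
Proof.
by elim: N z => [|N IH] z; rewrite ?hornerX // iterSr /= horner_comp IH.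
Qed.

Lemma deriv_iterpS N z :
  (iterp N.+1)^`().[z] = (iterp N)^`().[f.[z]] * f^`().[z].
Proof. by rewrite deriv_comp hornerM horner_comp. Qed.

Lemma iter_mul_period k x j : it f k x = x -> it f (j * k)%N x = x.
Proof. by move=> fx; elim: j => // j IH; rewrite mulSn iterD IH. Qed.

Lemma iter_mod_period k x i : it f k x = x -> it f i x = it f (i %% k) x.
Proof.
by move=> fx; rewrite {1}(divn_eq i k) addnC iterD iter_mul_period.
Qed.

End Iterates.

Section Escape.
Variables (R : realType).
Local Notation C := R[i]%C.
Variables (f : {poly C}) (r0 : R).
Hypothesis r0_ge1 : 1 <= r0.
Hypothesis esc_r0 : forall z, r0 <= cmod z -> 2 * cmod z <= cmod f.[z].

Definition escaping z := exists N, r0 <= cmod (it f N z).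

Lemma escape_growth N z : r0 <= cmod z -> 2 ^+ N * cmod z <= cmod (it f N z).
Proof.
move=> rz; elim: N => [|N IH]; first by rewrite mul1r.
have h : r0 <= cmod (it f N z).
  by apply: le_trans rz (le_trans _ IH); rewrite ler_peMl ?cmod_ge0 ?exprn_ege1 ?ler1n.
by rewrite iterS (le_trans _ (esc_r0 h)) // exprS -mulrA ler_wpM2l.
Qed.

Lemma escaping_preimage N w : escaping (it f N w) -> escaping w.
Proof. by case=> K; rewrite -iterD => h; exists (K + N)%N. Qed.

Lemma escaping_image N w : escaping w -> escaping (it f N w).
Proof.
case=> K h; exists K; rewrite -iterD addnC iterD.
apply: le_trans h (le_trans _ (escape_growth N h)).
by rewrite ler_peMl ?cmod_ge0 ?exprn_ege1 ?ler1n.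
Qed.

Lemma escaping_unbounded z (M : R) : escaping z ->
  exists K, forall N, (K <= N)%N -> M < cmod (it f N z).
Proof.
case=> K h; pose B := Num.Def.archi_bound `|M|; exists (B + K)%N => N hN.
have -> : N = (N - K + K)%N by rewrite subnK // (leq_trans _ hN) ?leq_addl.
rewrite iterD (lt_le_trans _ (escape_growth _ h)) //.
apply: le_lt_trans (ler_norm M) _.
apply: lt_le_trans (archi_boundP (normr_ge0 M)) _.
have : B%:R <= 2 ^+ (N - K) :> R.
  rewrite -natrX ler_nat (leq_trans (ltnW (ltn_expl B (ltnSn 1)))) //.
  by rewrite leq_exp2l // leq_subRL // ?(leq_trans _ hN) ?leq_addl // addnC.
move/le_trans; apply; rewrite ler_peMr ?exprn_ge0 //; exact: le_trans h.
Qed.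

(** The escaping set stays at a positive distance from [x]. *)
Definition separated x :=
  exists2 eta : R, 0 < eta & forall u, escaping u -> eta <= cmod (u - x).

Lemma separated_preimage x : separated f.[x] -> separated x.
Proof.
case=> eta eta0 sep.
have [B B0 HB] := poly_lipschitz f (cmod x + 1).
exists (Num.min 1 (eta / (B + 1))).
  by rewrite lt_min ltr01 divr_gt0 // ltr_wpDl.
move=> u eu; rewrite leNgt; apply/negP; rewrite lt_min => /andP[u1 ux].
have hu : cmod u <= cmod x + 1.
  by have := cmodD (u - x) x; rewrite subrK; lra.
have hx : cmod x <= cmod x + 1 by rewrite lerDl.
have := sep f.[u] (@escaping_image 1 u eu).
have := HB u x hu hx; move: ux; rewrite ltr_pdivlMr ?ltr_wpDl // => ux h1 h2.
have := cmod_ge0 (u - x); lra.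
Qed.

Lemma separated_iter N x : separated (it f N x) -> separated x.
Proof.
by elim: N x => // N IH x; rewrite iterSr => /IH /separated_preimage.
Qed.

(** Near [c] the return map [f^n] is quadratically small, so it maps a small
    disk around [c] into itself, and no orbit starting there is unbounded. *)
Lemma separated_superattracting n c :
  (0 < n)%N -> it f n c = c -> f^`().[c] = 0 -> separated c.
Proof.
case: n => // n _ fc dc.
have [B B0 HB] := poly_taylor (iterp f n.+1) (cmod c + 1).
pose eta : R := Num.min 1 (B + 1)^-1.
have B1 : 0 < B + 1 by rewrite ltr_wpDl.
have eta0 : 0 < eta by rewrite lt_min ltr01 invr_gt0.
have eta1 : eta <= 1 by rewrite ge_min lexx.
have etaB : B * eta <= 1.
  have : eta <= (B + 1)^-1 by rewrite ge_min lexx orbT.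
  rewrite -[X in _ <= X]div1r ler_pdivlMr //; lra.
have trap u : cmod (u - c) <= eta -> cmod (it f n.+1 u - c) <= eta.
  move=> hu; have := HB u c.
  rewrite deriv_iterpS dc mulr0 mul0r subr0 !horner_iterp fc => h.
  have hu' : cmod u <= cmod c + 1 by have := cmodD (u - c) c; rewrite subrK; lra.
  have {}h := h hu' _; apply: (le_trans (h _)); first by rewrite lerDl.
  have e2 : cmod (u - c) ^+ 2 <= eta ^+ 2.
    by rewrite ler_sqr ?nnegrE ?cmod_ge0 ?(ltW eta0).
  apply: (le_trans (ler_wpM2l B0 e2)).
  by rewrite expr2 mulrA -[leRHS]mul1r ler_wpM2r ?(ltW eta0).
exists eta => // u eu; rewrite leNgt; apply/negP => /ltW hu.
have [K HK] := escaping_unbounded (eta + cmod c) eu.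
have := HK (K * n.+1)%N (leq_pmulr _ _) => /(_ isT).
have : cmod (it f (K * n.+1)%N u - c) <= eta.
  by elim: K {HK} => [//|j IH]; rewrite mulSn iterD; exact: trap.
set y := it f _ u; have := cmodD (y - c) c; rewrite subrK; lra.
Qed.

(** Separation passes to preimages, and every point of the cycle of [c] is
    eventually mapped to [c]. *)
Lemma separated_cycle n i c :
  (0 < n)%N -> it f n c = c -> f^`().[c] = 0 -> separated (it f i c).
Proof.
move=> n0 fc dc; apply: (@separated_iter (n * i - i)).
rewrite -iterD subnK ?leq_pmull // mulnC iter_mul_period //.
exact: separated_superattracting n0 fc dc.
Qed.

Lemma separated_seq (s : seq C) : (forall x, x \in s -> separated x) ->
  exists2 eta : R, 0 < eta &
    forall u x, escaping u -> x \in s -> eta <= cmod (u - x).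
Proof.
elim: s => [|x s IH] h; first by exists 1.
have [|e e0 He] := IH; first by move=> y ys; apply: h; rewrite inE ys orbT.
have [e' e'0 He'] := h x (mem_head _ _).
exists (Num.min e e'); first by rewrite lt_min e0.
move=> u y eu; rewrite inE ge_min => /orP[/eqP->|/He ->//].
by rewrite He' ?orbT.
Qed.

End Escape.

(** * The area argument *)

Lemma sqr_le (R : realDomainType) (a b : R) : 0 <= a -> a <= b -> a ^+ 2 <= b ^+ 2.
Proof. by move=> a0 ab; rewrite ler_pM. Qed.

Section LocalDisks.
Variable R : rcfType.
Local Notation C := R[i]%C.
Variables (P : {poly C}) (rho B m delta : R).
Hypothesis taylor : forall u w, cmod u <= rho -> cmod w <= rho ->
  cmod (P.[u] - P.[w] - P^`().[w] * (u - w)) <= B * cmod (u - w) ^+ 2.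
Hypotheses (B0 : 0 <= B) (m0 : 0 < m) (delta0 : 0 < delta).
Hypothesis small : B * delta < m ^+ 2.

(** Half the radius of the disk that the linearization of [P] at [w] maps onto
    a disk of radius [delta]. The factor 1/2 leaves room for the nonlinear
    terms, which the bound on [B * delta] makes small. *)
Definition disk_radius w := delta / (2 * cmod P^`().[w]).

Lemma disk_radius_ge0 w : 0 <= disk_radius w.
Proof. by rewrite /disk_radius divr_ge0 ?(ltW delta0) // mulr_ge0 ?cmod_ge0. Qed.

Lemma disk_radius_le w : m <= cmod P^`().[w] -> disk_radius w <= delta / (2 * m).
Proof.
move=> h; have ? := lt_le_trans m0 h.
rewrite /disk_radius ler_wpM2l ?(ltW delta0) //.
by rewrite lef_pV2 ?posrE ?mulr_gt0 // ler_pM2l.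
Qed.

Lemma disk_image w u : m <= cmod P^`().[w] -> cmod u <= rho -> cmod w <= rho ->
  cmod (u - w) <= disk_radius w -> cmod (P.[u] - P.[w]) <= 3 / 4 * delta.
Proof.
move=> hm hu hw; rewrite /disk_radius; set D := cmod P^`().[w] in hm *.
have D0 : 0 < D := lt_le_trans m0 hm.
rewrite ler_pdivlMr ?mulr_gt0 // => hr; set t := cmod (u - w) in hr *.
have t0 : 0 <= t := cmod_ge0 _.
have := taylor hu hw; rewrite -/t => h.
have := cmodD (P.[u] - P.[w] - P^`().[w] * (u - w)) (P^`().[w] * (u - w)).
rewrite subrK [cmod (_ * (u - w))]cmodM -/t -/D => h2.
have e1 : D * t <= delta / 2 by rewrite ler_pdivlMr //; lra.
have e2 : (B * t ^+ 2) * D ^+ 2 <= delta / 4 * D ^+ 2.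
  have -> : B * t ^+ 2 * D ^+ 2 = B * (D * t) ^+ 2 by ring.
  have s1 : (D * t) ^+ 2 <= (delta / 2) ^+ 2.
    by apply: sqr_le => //; rewrite mulr_ge0 // ltW.
  apply: (le_trans (ler_wpM2l B0 s1)).
  have s2 : m ^+ 2 <= D ^+ 2 by rewrite sqr_le // ltW.
  have -> : B * (delta / 2) ^+ 2 = delta / 4 * (B * delta) by field.
  by rewrite ler_wpM2l ?divr_ge0 ?(ltW delta0) ?ltW // (lt_le_trans small).
rewrite ler_pM2r ?exprn_gt0 // in e2.
lra.
Qed.

(** Two roots of the same equation [P = z] are at distance at least
    [|P'| / B], by the Taylor bound; this exceeds the sum of the radii. *)
Lemma disk_disjoint w w' u :
    m <= cmod P^`().[w] -> m <= cmod P^`().[w'] ->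
    cmod w <= rho -> cmod w' <= rho -> P.[w] = P.[w'] ->
    cmod (u - w) <= disk_radius w -> cmod (u - w') <= disk_radius w' ->
  w = w'.
Proof.
move=> hm hm' hw hw' e hu hu'.
apply/eqP; rewrite -subr_eq0 -cmod_eq0 eq_le cmod_ge0 andbT leNgt; apply/negP => t0.
have := taylor hw hw'; rewrite e subrr sub0r cmodN cmodM => h.
have tt : cmod (w - w') <= delta / m.
  have := cmod_triangle w w' u; rewrite (cmodBC w u).
  have -> : delta / m = delta / (2 * m) + delta / (2 * m).
    by field; rewrite gt_eqF.
  have := disk_radius_le hm; have := disk_radius_le hm'; lra.
set t := cmod (w - w') in t0 h tt *.
rewrite expr2 mulrA ler_pM2r // in h.
rewrite ler_pdivlMr // in tt.
have : m * m <= B * t * m by rewrite ler_pM2r //; lra.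
have : B * (t * m) <= B * delta by rewrite ler_wpM2l.
by have := small; rewrite expr2; lra.
Qed.

End LocalDisks.

Section Grid.
Variable R : rcfType.
Local Notation C := R[i]%C.
Variables (z0 : C) (h : R).
Hypothesis h0 : 0 < h.

Definition grid (g : nat * nat) : C := z0 + ((h * g.1%:R) +i* (h * g.2%:R))%C.

Lemma grid_near G g : (g.1 < G)%N -> (g.2 < G)%N ->
  cmod (grid g - z0) <= h * (2 * G%:R - 2).
Proof.
case: g => a b /= aG bG; rewrite /grid addrC addKr (le_trans (cmod_rect _ _)) //=.
rewrite !ger0_norm ?mulr_ge0 ?(ltW h0) // -mulrDr ler_pM2l //.
by move: aG bG; rewrite -!(ler_nat R) -!natr1; lra.
Qed.

Lemma natr_dist (a b : nat) : a != b -> 1 <= `|a%:R - b%:R| :> R.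
Proof.
wlog : a b / (b < a)%N => [W|ba _].
  by case: (ltngtP a b) => // ab _; [rewrite distrC|]; apply: W => //; rewrite gtn_eqF.
by rewrite ger0_norm -?natrB ?ler1n ?subn_gt0 ?ler0n // ltnW.
Qed.

Lemma grid_sep g g' : g != g' -> h <= cmod (grid g - grid g').
Proof.
case: g g' => [a b] [a' b']; rewrite xpair_eqE negb_and /grid /= => /orP[]ne.
  apply: le_trans (Re_le_cmod _); rewrite opprD addrACA subrr add0r /=.
  by rewrite -mulrBr normrM gtr0_norm // ler_peMr ?(ltW h0) // natr_dist.
apply: le_trans (Im_le_cmod _); rewrite opprD addrACA subrr add0r /=.
by rewrite -mulrBr normrM gtr0_norm // ler_peMr ?(ltW h0) // natr_dist.
Qed.

End Grid.

Section Rigidity.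
Variables (R : realType).
Local Notation C := R[i]%C.
Variables (f : {poly C}) (r0 : R).
Hypothesis esc_r0 : forall z, r0 <= cmod z -> 2 * cmod z <= cmod f.[z].
Notation escaping := (escaping f r0).
Variables (q : C -> C) (M m0 : R).
Hypothesis M0 : 0 < M.
Hypothesis qM : forall u, escaping u -> cmod (q u) <= M.
Hypotheses (m0_gt0 : 0 < m0) (m0_le1 : m0 <= 1).
Hypothesis fm0 : forall u, escaping u -> m0 <= cmod f^`().[u].
Hypothesis q_push : forall z, escaping z -> exists us : seq C,
  [/\ uniq us, forall u, u \in us -> f.[u] = z &
      q z = \sum_(u <- us) q u / f^`().[u] ^+ 2].

Lemma escaping_ge z : r0 <= cmod z -> escaping z. Proof. by exists 0. Qed.

(** One more iterate replaces each [w] by its preimages under [f], and the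
    chain rule multiplies the weights. *)
Lemma pushforward_iter N z : escaping z -> exists ws : seq C,
  [/\ uniq ws, forall w, w \in ws -> it f N w = z &
      q z = \sum_(w <- ws) q w / (iterp f N)^`().[w] ^+ 2].
Proof.
move=> ez; elim: N => [|N [ws [uws fws qws]]].
  exists [:: z]; split=> // [w|]; first by rewrite inE => /eqP.
  by rewrite big_seq1 /iterp /= derivX hornerC expr1n divr1.
have /choice[U HU] : forall w, exists us : seq C, [/\ uniq us,
    forall u, u \in us -> f.[u] = w &
    escaping w -> q w = \sum_(u <- us) q u / f^`().[u] ^+ 2].
  move=> w; case: (pselect (escaping w)) => [ew|new].
    by have [us [? ? ?]] := q_push ew; exists us.
  by exists [::].
exists [seq u | w <- ws, u <- U w]; split.
- apply: allpairs_uniq_dep => // [w _|]; first by case: (HU w).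
  move=> [w u] [w' u'] /allpairsPdep[x [y [xs ys [-> ->]]]].
  move=> /allpairsPdep[x' [y' [xs' ys' [-> ->]]]] /= yy.
  rewrite -yy in ys' *.
  by have [_ /(_ _ ys) <- _] := HU x; have [_ /(_ _ ys') <- _] := HU x'.
- move=> v /allpairsPdep[w [u [ww uu ->]]]; rewrite iterSr.
  by have [_ /(_ _ uu) -> _] := HU w; exact: fws.
- rewrite big_allpairs_dep qws big_seq [RHS]big_seq; apply: eq_bigr => w win.
  have ew : escaping w by apply: (@escaping_preimage _ _ _ N); rewrite fws.
  have [_ fU /(_ ew) ->] := HU w.
  rewrite mulr_suml big_seq [RHS]big_seq; apply: eq_bigr => u uin.
  by rewrite deriv_iterpS (fU _ uin) exprMn [in RHS]invfM mulrA mulrAC.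
Qed.

Lemma deriv_iterp_ge N w : escaping w -> m0 ^+ N <= cmod (iterp f N)^`().[w].
Proof.
elim: N w => [|N IH] w ew; first by rewrite /iterp /= derivX hornerC cmod1.
rewrite deriv_iterpS cmodM exprSr ler_pM ?exprn_ge0 ?(ltW m0_gt0) ?fm0 // IH //.
exact: (escaping_image esc_r0 1 ew).
Qed.

(** Fix a large number [L] of iterates, then a grid of mesh [2 * delta] in the
    disk of radius [r] around [z0], with [delta] so small that the first [L]
    iterates are almost linear at scale [delta] near all the preimages
    involved. Around each preimage [w] of a grid point under [f^N], [N < L],
    take the disk of radius [delta / (2 |(f^N)'(w)|)]. All these disks are
    disjoint: for one [N], by injectivity near each [w] and because distinct
    grid points are [2 * delta] apart; for different [N], because a point of
    the disk around [z0] never comes back there, its modulus being at least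
    doubled. They lie in a disk whose radius [rho] does not depend on [L].
    Invariance of [q] and the bounds on [q] give the disks over a single grid
    point and a single [N] a total squared radius of at least
    [delta^2 sigma / (4 M)], so the whole family has at least [L] times a
    constant. For [L] large this contradicts the packing bound. *)
Theorem no_invariant_density z0 (r sigma : R) :
    0 < r -> 0 < sigma -> r0 + r <= cmod z0 -> 3 * r < cmod z0 ->
    (forall z, cmod (z - z0) <= r -> sigma <= cmod (q z)) ->
  False.
Proof.
move=> r_gt0 sigma0 z0r z0r3 qsigma.
have near_esc z : cmod (z - z0) <= r -> r0 <= cmod z.
  by move=> hz; have := cmod_triangle z0 0 z; rewrite !subr0 cmodBC; lra.
pose rho := cmod z0 + r + 1.
have rho0 : 0 <= rho by rewrite /rho; have := cmod_ge0 z0; lra.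
have pre_le N w z : cmod (z - z0) <= r -> it f N w = z -> cmod w <= rho - 1.
  move=> hz fw; have zle : cmod z <= cmod z0 + r.
    by have := cmodD (z - z0) z0; rewrite subrK; lra.
  rewrite /rho addrK; case: (leP r0 (cmod w)) => [rw|]; last by lra.
  have := escape_growth esc_r0 N rw; rewrite fw.
  have : cmod w <= 2 ^+ N * cmod w by rewrite ler_peMl ?cmod_ge0 ?exprn_ege1 ?ler1n.
  lra.
(* The disk of radius [r] around [z0] is disjoint from its forward images. *)
have wandering N K u : (N < K)%N -> cmod (it f N u - z0) <= r ->
    cmod (it f K u - z0) <= r -> False.
  move=> NK hN hK; have [j Kj] : exists j, K = (j.+1 + N)%N.
    by exists (K - N.+1)%N; rewrite addSnnS subnK.
  have := escape_growth esc_r0 j.+1 (near_esc _ hN).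
  rewrite -iterD -Kj exprS -mulrA.
  have e1 := cmod_triangle z0 0 (it f N u); have e2 := cmodD (it f K u - z0) z0.
  rewrite !subr0 cmodBC in e1; rewrite subrK in e2.
  set t := cmod (it f N u) in e1 *.
  have : t <= 2 ^+ j * t by rewrite ler_peMl ?cmod_ge0 ?exprn_ege1 ?ler1n.
  lra.
have [L HL] : exists L : nat, 256 * rho ^+ 2 * M < L%:R * (sigma * r ^+ 2).
  exists (Num.Def.archi_bound (256 * rho ^+ 2 * M / (sigma * r ^+ 2))).
  rewrite -ltr_pdivrMr ?mulr_gt0 ?exprn_gt0 // archi_boundP //.
  by rewrite divr_ge0 ?mulr_ge0 ?exprn_ge0 // ltW.
pose m := m0 ^+ L.
have m_gt0 : 0 < m by rewrite exprn_gt0.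
have m_le N w : (N < L)%N -> escaping w -> m <= cmod (iterp f N)^`().[w].
  move=> NL ew; apply: le_trans (deriv_iterp_ge N ew).
  by rewrite ler_wiXn2l ?(ltW m0_gt0) // ltnW.
have [B B0 HB] : exists2 B : R, 0 <= B & forall N, (N < L)%N -> forall u w,
    cmod u <= rho -> cmod w <= rho ->
    cmod ((iterp f N).[u] - (iterp f N).[w] - (iterp f N)^`().[w] * (u - w))
      <= B * cmod (u - w) ^+ 2.
  elim: (L) => [|k [B B0 HB]]; first by exists 0.
  have [B' B'0 HB'] := poly_taylor (iterp f k) rho.
  exists (B + B'); first exact: addr_ge0.
  move=> N; rewrite ltnS leq_eqVlt => /orP[/eqP-> u w hu hw|Nk u w hu hw]; rewrite mulrDl.
    by rewrite (le_trans (HB' _ _ hu hw)) // lerDr mulr_ge0 ?exprn_ge0 ?cmod_ge0.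
  by rewrite (le_trans (HB _ Nk _ _ hu hw)) // lerDl mulr_ge0 ?exprn_ge0 ?cmod_ge0.
(* [delta < eps] makes the radii at most 1 and the nonlinear terms small. *)
pose eps := Num.min m (m ^+ 2 / (B + 1)).
have eps0 : 0 < eps by rewrite lt_min m_gt0 divr_gt0 ?exprn_gt0 // ltr_wpDl.
have [G G0 GP] : exists2 G : nat, 0 < G%:R :> R & r / (4 * eps) < G%:R.
  exists (Num.Def.archi_bound (r / (4 * eps))).+1; first by rewrite ltr0n.
  apply: lt_trans (archi_boundP _) _; last by rewrite ltr_nat.
  by rewrite divr_ge0 ?mulr_ge0 // ltW.
pose delta := r / (4 * G%:R).
have delta0 : 0 < delta by rewrite divr_gt0 ?mulr_gt0.
have delta_eps : delta < eps.
  by move: GP; rewrite /delta !ltr_pdivrMr ?mulr_gt0 //; lra.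
have rG : r = delta * (4 * G%:R) by rewrite /delta divfK // gt_eqF ?mulr_gt0.
have delta_m : delta <= m by apply: ltW (lt_le_trans delta_eps _); rewrite ge_min lexx.
have Bdelta : B * delta < m ^+ 2.
  have : delta < m ^+ 2 / (B + 1).
    by apply: lt_le_trans delta_eps _; rewrite ge_min lexx orbT.
  rewrite ltr_pdivlMr ?ltr_wpDl //; lra.
pose pt := grid z0 (2 * delta).
have d20 : 0 < 2 * delta by rewrite mulr_gt0.
pose inG (g : nat * nat) := (g.1 < G)%N && (g.2 < G)%N.
have pt_near g : inG g -> cmod (pt g - z0) <= r - 4 * delta.
  by case/andP => g1 g2; have := grid_near z0 d20 g1 g2; rewrite -/pt; lra.
have /choice[W HW] : forall x : nat * (nat * nat), exists ws : seq C, inG x.2 ->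
   [/\ uniq ws, forall w, w \in ws -> it f x.1 w = pt x.2 &
     q (pt x.2) = \sum_(w <- ws) q w / (iterp f x.1)^`().[w] ^+ 2].
  move=> -[N g]; case: (boolP (inG g)) => [ig|]; last by exists [::].
  have [|ws Hws] := @pushforward_iter N (pt g).
    by apply/escaping_ge/near_esc; have := pt_near g ig; lra.
  by exists ws.
pose X := [seq (N, g) | N <- iota 0 L, g <- [seq (a, b) | a <- iota 0 G, b <- iota 0 G]].
have XP x : x \in X -> (x.1 < L)%N /\ inG x.2.
  case/allpairsP => -[N g] /= [NL gG ->] /=; move: NL gG.
  rewrite mem_iota add0n => /= -> /allpairsP[[a b] [/=]].
  by rewrite !mem_iota !add0n /inG => /= aG bG -> /=; rewrite aG bG.
pose rad (N : nat) w := disk_radius (iterp f N) delta w.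
(* The centres of the disks, tagged by the iterate and the grid point. *)
pose items := [seq (x, w) | x <- X, w <- W x].
have itemsP i : i \in items -> [/\ (i.1.1 < L)%N, inG i.1.2, i.2 \in W i.1,
    it f i.1.1 i.2 = pt i.1.2 & [/\ cmod i.2 <= rho - 1,
    m <= cmod (iterp f i.1.1)^`().[i.2] & escaping i.2]].
  case/allpairsPdep => x [w [xX wW ->]] /=; have [xL xG] := XP x xX.
  have [_ /(_ _ wW) fw _] := HW x xG.
  have nr : cmod (pt x.2 - z0) <= r by have := pt_near _ xG; lra.
  have ew : escaping w.
    by apply: (@escaping_preimage _ _ _ x.1); rewrite fw; exact/escaping_ge/near_esc.
  by split=> //; split=> //; [exact: pre_le nr fw|exact: m_le].
have rad_small i : i \in items -> 0 <= rad i.1.1 i.2 <= 1.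
  case/itemsP => _ _ _ _ [_ hm _]; apply/andP; split.
    exact: disk_radius_ge0.
  apply: le_trans (disk_radius_le m_gt0 delta0 hm) _.
  by rewrite ler_pdivrMr ?mulr_gt0 // ; lra.
have packing : \sum_(i <- items) rad i.1.1 i.2 ^+ 2 <= 4 * rho ^+ 2.
  apply: (@disk_packing _ _ items (fun i => i.2) (fun i => rad i.1.1 i.2)) => //.
  - apply: allpairs_uniq_dep.
    + have ug : uniq [seq (a, b) | a <- iota 0 G, b <- iota 0 G].
        by apply: allpairs_uniq; rewrite ?iota_uniq // => -[? ?] [? ?].
      by apply: allpairs_uniq; rewrite ?iota_uniq // => -[? ?] [? ?].
    + by move=> x /XP[_ /HW[]].
    + by move=> [x w] [x' w'] _ _ /= [-> ->].
  - move=> i ii; have /andP[-> r1] := rad_small i ii; split=> //.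
    by have [_ _ _ _ [h _ _]] := itemsP i ii; lra.
  - move=> i j u ii jj ij ui uj.
    have [iL iG _ fi [ri mi ei]] := itemsP i ii.
    have [jL jG _ fj [rj mj ej]] := itemsP j jj.
    have /andP[_ radi] := rad_small i ii; have /andP[_ radj] := rad_small j jj.
    have urho : cmod u <= rho by have := cmodD (u - i.2) i.2; rewrite subrK; lra.
    have irho : cmod i.2 <= rho by lra.
    have jrho : cmod j.2 <= rho by lra.
    have imi := disk_image (HB _ iL) B0 m_gt0 delta0 Bdelta mi urho irho ui.
    have imj := disk_image (HB _ jL) B0 m_gt0 delta0 Bdelta mj urho jrho uj.
    rewrite !horner_iterp fi in imi; rewrite !horner_iterp fj in imj.
    have ni := pt_near _ iG; have nj := pt_near _ jG.
    have ui0 : cmod (it f i.1.1 u - z0) <= r.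
      by have := cmod_triangle (it f i.1.1 u) z0 (pt i.1.2); lra.
    have uj0 : cmod (it f j.1.1 u - z0) <= r.
      by have := cmod_triangle (it f j.1.1 u) z0 (pt j.1.2); lra.
    case: (ltngtP i.1.1 j.1.1) => [lt|lt|eN].
    + exact: wandering lt ui0 uj0.
    + exact: wandering lt uj0 ui0.
    rewrite -eN in imj fj mj uj.
    case: (eqVneq i.1.2 j.1.2) => [eg|ng]; last first.
      have := grid_sep z0 d20 ng; rewrite -/(pt _) -/(pt _).
      have := cmod_triangle (pt i.1.2) (pt j.1.2) (it f i.1.1 u).
      rewrite (cmodBC (pt i.1.2) (it _ _ _)); lra.
    have ew : i.2 = j.2.
      apply: (disk_disjoint (HB _ iL) B0 m_gt0 delta0 Bdelta mi mj irho jrho _ ui uj).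
      by rewrite !horner_iterp fi fj eg.
    by case/eqP: ij; apply: injective_projections => //; apply: injective_projections.
have low x : x \in X -> delta ^+ 2 / 4 * (sigma / M) <=
    \sum_(w <- W x) rad x.1 w ^+ 2.
  move=> xX; have [xL xG] := XP x xX; have [_ fW qW] := HW x xG.
  have nr : cmod (pt x.2 - z0) <= r by have := pt_near _ xG; lra.
  have := qsigma _ nr; rewrite qW => /le_trans/(_ (cmod_sum _ _)) h.
  have e : \sum_(w <- W x) cmod (q w / (iterp f x.1)^`().[w] ^+ 2) <=
      M * (4 / delta ^+ 2) * \sum_(w <- W x) rad x.1 w ^+ 2.
    rewrite mulr_sumr big_seq [leRHS]big_seq; apply: ler_sum => w wW.
    have ew : escaping w.
      by apply: (@escaping_preimage _ _ _ x.1); rewrite fW //; exact/escaping_ge/near_esc.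
    have D0 := lt_le_trans m_gt0 (m_le _ _ xL ew).
    rewrite cmodM cmodV cmodX /rad /disk_radius.
    set D := cmod _^`().[w] in D0 *.
    have -> : M * (4 / delta ^+ 2) * (delta / (2 * D)) ^+ 2 = M / D ^+ 2.
      by field; rewrite !gt_eqF.
    by rewrite ler_wpM2r ?invr_ge0 ?exprn_ge0 ?qM // ltW.
  have {h e} h := le_trans h e.
  have -> : delta ^+ 2 / 4 * (sigma / M) = sigma / (M * (4 / delta ^+ 2)).
    by field; rewrite !gt_eqF.
  rewrite ler_pdivrMr 1?mulrC //; last by rewrite mulr_gt0 // divr_gt0 // exprn_gt0.
have : L%:R * (r ^+ 2 / 64 * (sigma / M)) <= 4 * rho ^+ 2.
  apply: le_trans packing; rewrite big_allpairs_dep.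
  apply: le_trans (_ : \sum_(x <- X) (delta ^+ 2 / 4 * (sigma / M)) <= _); last first.
    by rewrite big_seq [leRHS]big_seq; apply: ler_sum => x /low.
  rewrite big_const_seq count_predT iter_addr_0 /X !size_allpairs !size_iota.
  rewrite -[leRHS]mulr_natr !natrM rG.
  by rewrite le_eqVlt; apply/orP; left; apply/eqP; field; rewrite gt_eqF.
have -> : L%:R * (r ^+ 2 / 64 * (sigma / M)) = L%:R * (sigma * r ^+ 2) / (64 * M).
  by field; rewrite gt_eqF.
rewrite ler_pdivrMr ?mulr_gt0 //; lra.
Qed.

End Rigidity.

(** * Polynomials with critical points 0 and 1 *)

Section CharZero.
Variable F : numFieldType.
Implicit Types (p f V : {poly F}).

Lemma size_deriv0 p : size p^`() = (size p).-1.
Proof.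
case E: (size p) => [|[|n]] /=.
- by move/eqP: E; rewrite size_poly_eq0 => /eqP->; rewrite deriv0 size_poly0.
- have /size1_polyC-> : (size p <= 1)%N by rewrite E.
  by rewrite derivC size_poly0.
apply/eqP; rewrite eqn_leq -ltnS -E lt_size_deriv -?size_poly_gt0 ?E //=.
rewrite ltnNge; apply/negP => /leq_sizeP/(_ n (leqnn n)); rewrite coef_deriv => /eqP.
rewrite mulrn_eq0 /= => /eqP h; have : lead_coef p != 0.
  by rewrite lead_coef_eq0 -size_poly_gt0 E.
by rewrite lead_coefE E h eqxx.
Qed.

Lemma deriv_eq0 p : p^`() = 0 -> p = (p.[0])%:P.
Proof.
move=> h; have /size1_polyC {1}-> : (size p <= 1)%N.
  by have := size_deriv0 p; rewrite h size_poly0; case: (size p) => [|[]].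
by rewrite horner_coef0.
Qed.

(** In characteristic zero differentiation lowers the order of a root by
    exactly one. *)
Lemma dvdp_antideriv p x k :
  root p x -> ('X - x%:P) ^+ k %| p^`() -> ('X - x%:P) ^+ k.+1 %| p.
Proof.
have [->|p0] := eqVneq p 0; first by rewrite dvdp0.
move=> rx; have [[|j] [g]] := multiplicity_XsubC p x; rewrite p0 /=.
  by move=> gx E; move: rx gx; rewrite E mulr1 => ->.
move=> gx E; have dE : p^`() = (g^`() * ('X - x%:P) + g *+ j.+1) * ('X - x%:P) ^+ j.
  rewrite E derivM deriv_exp derivXsubC mul1r exprS /=.
  by rewrite -mulr_natr -[g *+ _]mulr_natr; ring.
rewrite dE; set h : {poly F} := g^`() * _ + _.
have hx : ~~ root h x.
  rewrite rootE /h hornerD hornerM hornerXsubC subrr mulr0 add0r hornerMn.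
  by rewrite mulrn_eq0 /= -rootE.
rewrite Gauss_dvdpr; last first.
  by rewrite coprimep_expl // coprimep_sym coprimep_XsubC.
rewrite dvdp_Pexp2l ?size_XsubC // => kj.
by rewrite E dvdp_mull // dvdp_exp2l.
Qed.

Section TwoCriticalPoints.
Variables (f : {poly F}) (K : F) (k0 k1 : nat).
Hypothesis K0 : K != 0.
Hypotheses (k0_gt0 : (0 < k0)%N) (k1_gt0 : (0 < k1)%N).
Hypothesis df : f^`() = K *: ('X ^+ k0 * ('X - 1) ^+ k1).

Lemma size_deriv_two_crit : size f^`() = (k0 + k1).+1.
Proof.
rewrite df size_scale // size_mul ?monic_neq0 ?monic_exp ?monicX ?monicXsubC //.
by rewrite size_polyXn -polyC1 size_exp_XsubC addnS.
Qed.

Lemma size_two_crit : size f = (size f^`()).+1.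
Proof.
have := size_deriv0 f; rewrite {2}size_deriv_two_crit.
by rewrite size_deriv_two_crit; case: (size f) => //= n <-.
Qed.

Lemma size_two_crit_gt2 : (2 < size f)%N.
Proof.
by rewrite size_two_crit size_deriv_two_crit !ltnS addn_gt0 k0_gt0.
Qed.

Lemma deriv_at0 : f^`().[0] = 0.
Proof.
by rewrite df !(hornerZ, hornerM, hornerXn) expr0n eqn0Ngt k0_gt0 mul0r mulr0.
Qed.

Lemma deriv_at1 : f^`().[1] = 0.
Proof.
rewrite df !(hornerZ, hornerM, horner_exp) -polyC1 hornerXsubC subrr.
by rewrite expr0n eqn0Ngt k1_gt0 !mulr0.
Qed.

(** At each of the two critical points the right-hand side vanishes to one
    order more than [f'], which also makes the quotient vanish there. *)
Lemma critical_value_quotient : exists V : {poly F},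
  [/\ V * f^`() = (f - (f.[0])%:P) * (f - (f.[1])%:P),
      V.[0] = 0, V.[1] = 0 & (size V <= (size f).+1)%N].
Proof.
have /dvdpP[g0 E0] : ('X - 0%:P) ^+ k0.+1 %| f - (f.[0])%:P.
  apply: dvdp_antideriv; first by rewrite rootE !hornerE subrr.
  by rewrite derivB derivC subr0 df subr0 dvdpZr // dvdp_mulr.
have /dvdpP[g1 E1] : ('X - 1%:P) ^+ k1.+1 %| f - (f.[1])%:P.
  apply: dvdp_antideriv; first by rewrite rootE !hornerE subrr.
  by rewrite derivB derivC subr0 df polyC1 dvdpZr // dvdp_mull.
pose V : {poly F} := K^-1 *: (g0 * 'X * (g1 * ('X - 1))).
have VE : V * f^`() = (f - (f.[0])%:P) * (f - (f.[1])%:P).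
  rewrite E0 E1 df subr0 polyC1 /V -!mul_polyC.
  have KK : K^-1%:P * K%:P = 1 :> {poly F} by rewrite -polyCM mulVf.
  rewrite !exprS; set A := K^-1%:P; set B := K%:P.
  transitivity (A * B * (g0 * ('X * 'X ^+ k0) * (g1 * (('X - 1) * ('X - 1) ^+ k1)))).
    ring.
  by rewrite KK mul1r.
exists V; split => //.
- by rewrite /V !(hornerZ, hornerM) hornerX !(mulr0, mul0r).
- by rewrite /V !(hornerZ, hornerM) -polyC1 hornerXsubC subrr !mulr0.
have f0 : f^`() != 0 by rewrite -size_poly_gt0 size_deriv_two_crit.
have [->|V0] := eqVneq V 0; first by rewrite size_poly0.
have sB (c : F) : (size (f - c%:P)%R <= size f)%N.
  rewrite (leq_trans (size_polyD _ _)) // size_polyN geq_max leqnn.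
  rewrite (leq_trans (size_polyC_leq1 _)) //.
  exact: ltnW (ltnW size_two_crit_gt2).
have : (size (V * f^`())%R <= (size f + size f).-1)%N.
  rewrite VE (leq_trans (size_polyMleq _ _)) // -!subn1 leq_sub2r //.
  by rewrite leq_add.
rewrite size_mul // size_two_crit size_deriv_two_crit; move: (size V) => a. lia.
Qed.

End TwoCriticalPoints.

End CharZero.

(** * Rigidity: an invariant quadratic differential vanishes *)

Section SimpleFractions.
Variable R : realType.
Local Notation C := R[i]%C.
Variables (s : seq C) (c : C -> C).
Hypothesis us : uniq s.

Definition simple_fractions z := \sum_(x <- s) c x / (z - x).

(** Clearing denominators turns the sum into a polynomial [G] of degree less
    than the number of poles, which has infinitely many zeros near infinity;
    the value of [G] at a pole is a nonzero multiple of the residue there. *)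
Lemma simple_fractions_inj (rho : R) :
    (forall x, x \in s -> cmod x < rho) ->
    (forall z, rho <= cmod z -> simple_fractions z = 0) ->
  {in s, forall x, c x = 0}.
Proof.
move=> srho sf0.
pose p : {poly C} := \prod_(y <- s) ('X - y%:P).
pose G : {poly C} := \sum_(x <- s) c x *: (p %/ ('X - x%:P)).
have rp x : x \in s -> root p x by move=> xs; rewrite root_prod_XsubC.
have p0 : p != 0 by rewrite monic_neq0 // monic_prod_XsubC.
have szp : size p = (size s).+1 by rewrite size_prod_XsubC.
have GE z : (forall x, x \in s -> z != x) -> G.[z] = p.[z] * simple_fractions z.
  move=> zs; rewrite horner_sum mulr_sumr big_seq [RHS]big_seq.
  apply: eq_bigr => x xs; have zx : z - x != 0 by rewrite subr_eq0 zs.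
  by rewrite hornerZ (horner_divp_XsubC z (rp x xs)); field.
have [t ut [szt tbig]] : exists2 t : seq C, uniq t &
    size t = size s /\ forall z, z \in t -> rho <= cmod z.
  pose N := Num.Def.archi_bound `|rho|.
  pose h (i : nat) : C := i%:R.
  exists [seq h i | i <- iota N (size s)].
    by rewrite map_inj_uniq ?iota_uniq // => i j /eqP; rewrite eqr_nat => /eqP.
  rewrite size_map size_iota; split => // z; case/mapP => i; rewrite mem_iota => /andP[Ni _] ->.
  rewrite /h cmod_nat (le_trans (ler_norm _)) // (le_trans (ltW (archi_boundP _))) //.
  by rewrite ler_nat.
have G0 : G = 0.
  apply: (@roots_geq_poly_eq0 _ _ t) => //; last first.
    rewrite szt /G big_seq (leq_trans (size_sum _ _ _)) //.
    apply/bigmax_leqP_seq => x xs _; rewrite (leq_trans (size_scale_leq _ _)) //.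
    by rewrite size_divp ?polyXsubC_eq0 // size_XsubC szp subn1.
  apply/allP => z zt; rewrite rootE GE ?sf0 ?mulr0 ?tbig // => x xs.
  by apply: contraTneq (tbig _ zt) => ->; rewrite -ltNge srho.
move=> x xs; have := congr1 (fun g => g.[x]) G0.
rewrite horner0 horner_sum (bigD1_seq x) //= big1_seq ?addr0; last first.
  move=> y /andP[yx ys]; rewrite hornerZ.
  have := horner_divp_XsubC x (rp y ys); rewrite (rootP (rp x xs)) => /esym/eqP.
  by rewrite mulf_eq0 subr_eq0 [x == y]eq_sym (negPf yx) orbF => /eqP ->; rewrite mulr0.
have -> : p %/ ('X - x%:P) = \prod_(y <- s | y != x) ('X - y%:P).
  by rewrite /p (bigD1_seq x) //= mulKp // polyXsubC_eq0.
rewrite hornerZ horner_prod => /eqP; rewrite mulf_eq0 => /orP[/eqP//|].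
rewrite prodf_seq_eq0 => /hasP[y _ /andP[yx]].
by rewrite hornerXsubC subr_eq0 eq_sym (negPf yx).
Qed.

Lemma cmod_simple_fractions (eta : R) z : 0 < eta ->
    (forall x, x \in s -> eta <= cmod (z - x)) ->
  cmod (simple_fractions z) <= (\sum_(x <- s) cmod (c x)) / eta.
Proof.
move=> eta0 sep; rewrite (le_trans (cmod_sum _ _)) // mulr_suml big_seq [leRHS]big_seq.
apply: ler_sum => x xs; rewrite cmodM cmodV ler_wpM2l ?cmod_ge0 //.
by rewrite lef_pV2 ?posrE ?sep // (lt_le_trans eta0) ?sep.
Qed.

Lemma simple_fractions_lipschitz z w :
    (forall x, x \in s -> 1 <= cmod (z - x)) ->
    (forall x, x \in s -> 1 <= cmod (w - x)) ->
  cmod (simple_fractions z - simple_fractions w)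
    <= (\sum_(x <- s) cmod (c x)) * cmod (z - w).
Proof.
move=> hz hw; rewrite -sumrB (le_trans (cmod_sum _ _)) // mulr_suml.
rewrite big_seq [leRHS]big_seq; apply: ler_sum => x xs.
have z1 := hz x xs; have w1 := hw x xs.
have zx : z - x != 0 by rewrite -cmod_gt0 (lt_le_trans ltr01).
have wx : w - x != 0 by rewrite -cmod_gt0 (lt_le_trans ltr01).
have -> : c x / (z - x) - c x / (w - x) = c x * (w - z) * ((z - x) * (w - x))^-1.
  by field; rewrite zx wx.
rewrite !cmodM cmodV cmodM (cmodBC w) -[leRHS]mulr1 ler_wpM2l ?mulr_ge0 ?cmod_ge0 //.
rewrite invf_le1 ?mulr_gt0 ?cmod_gt0 //; apply: (le_trans z1).
by rewrite ler_peMr ?cmod_ge0.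
Qed.

End SimpleFractions.

Lemma simple_roots_seq (F : closedFieldType) (p : {poly F}) :
    p != 0 -> (forall u, root p u -> p^`().[u] != 0) ->
  exists us : seq F, [/\ uniq us, all (root p) us & (size us).+1 = size p].
Proof.
move=> p0 dp; have [us E] := closed_field_poly_normal p.
have l0 : lead_coef p != 0 by rewrite lead_coef_eq0.
have rE u : root p u = (u \in us) by rewrite E rootZ // root_prod_XsubC.
exists us; split; last 1 first.
- by rewrite E size_scale // size_prod_XsubC.
- apply: count_mem_uniq => u; case: (boolP (u \in us)) => [uin|/count_memPn //].
  apply/eqP; rewrite eqn_leq -has_count has_pred1 uin andbT leqNgt; apply/negP => c2.
  have : ('X - u%:P) ^+ 2 %| p.
    by rewrite E dvdpZr // -mup_geq ?mu_prod_XsubC // monic_neq0 // monic_prod_XsubC.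
  case/dvdpP => g Eg; have := dp u; rewrite rE uin => /(_ isT).
  rewrite Eg derivM deriv_exp derivXsubC mul1r expr1 /=.
  by rewrite hornerD !hornerM hornerMn hornerXsubC subrr !(mulr0, mul0rn, addr0) eqxx.
- by apply/allP => u; rewrite rE.
Qed.

Section CriticalRigidity.
Variables (R : realType).
Local Notation C := R[i]%C.
Variables (f : {poly C}) (K : C) (k0 k1 n m : nat) (lam mu : C).
Hypothesis K0 : K != 0.
Hypotheses (k0_gt0 : (0 < k0)%N) (k1_gt0 : (0 < k1)%N).
Hypothesis df : f^`() = K *: ('X ^+ k0 * ('X - 1) ^+ k1).
Hypotheses (n0 : (0 < n)%N) (m0 : (0 < m)%N).
Hypotheses (fn1 : it f n 1 = 1) (fm0 : it f m 0 = 0).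
Local Notation pcs := (pc_sum f n m lam mu).
Local Notation q := (quad f n m lam mu).
Hypothesis sum1 : pcs (fun=> 1) = 0.
Hypothesis sumX : pcs (fun x => x) = 0.

Definition post_crit : seq C :=
  undup ([seq it f i 1 | i <- iota 0 n] ++ [seq it f i 0 | i <- iota 0 m]).

Lemma orbit1_post_crit i : it f i 1 \in post_crit.
Proof.
rewrite mem_undup mem_cat; apply/orP; left; apply/mapP; exists (i %% n)%N.
  by rewrite mem_iota add0n /= ltn_mod.
exact: iter_mod_period.
Qed.

Lemma orbit0_post_crit i : it f i 0 \in post_crit.
Proof.
rewrite mem_undup mem_cat; apply/orP; right; apply/mapP; exists (i %% m)%N.
  by rewrite mem_iota add0n /= ltn_mod.
exact: iter_mod_period.
Qed.

Lemma post_critP x : x \in post_crit -> exists i, x = it f i 1 \/ x = it f i 0.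
Proof.
rewrite mem_undup mem_cat => /orP[]/mapP[i _ ->]; exists i; [by left|by right].
Qed.

Definition residue x := pcs (fun y => (y == x)%:R).

(** Points of the two orbits may coincide; collecting their weights by
    position shows that [quad] has at most simple poles, at distinct points. *)
Lemma pc_sum_residue h : pcs h = \sum_(x <- post_crit) residue x * h x.
Proof.
transitivity (\sum_(x <- post_crit) pcs (fun y => h x * (y == x)%:R)).
  rewrite -pc_sum_big; have E y : y \in post_crit ->
      h y = \sum_(x <- post_crit) h x * (y == x)%:R.
    move=> yP; rewrite (bigD1_seq y) ?undup_uniq //= eqxx mulr1 big1 ?addr0 // => x.
    by rewrite eq_sym => /negPf ->; rewrite mulr0.
  by apply: eq_pc_sum => i; apply: E; rewrite ?orbit1_post_crit ?orbit0_post_crit.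
by apply: eq_bigr => x _; rewrite pc_sumZ mulrC.
Qed.

Lemma quad_simple_fractions z : q z = simple_fractions post_crit residue z.
Proof. by rewrite /quad pc_sum_residue. Qed.

(** The poles of [q] and the critical points of [f] all lie on the two
    superattracting cycles, away from the escaping set. This supplies the
    bounds that [no_invariant_density] needs; that [q] is Lipschitz near
    infinity gives a disk around [z0] on which it stays away from 0. *)
Theorem quad_vanishes_at_infinity (r0 : R) :
    1 <= r0 -> (forall z, r0 <= cmod z -> 2 * cmod z <= cmod f.[z]) ->
  forall z, r0 + 4 <= cmod z -> q z = 0.
Proof.
move=> r0_ge1 esc z0 hz0; apply/eqP/negPn/negP => q0.
have d0 := deriv_at0 k0_gt0 df; have d1 := deriv_at1 k1_gt0 df.
have sep x : x \in post_crit -> separated f r0 x.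
  by case/post_critP => i [->|->]; [exact: separated_cycle n0 fn1 d1|exact: separated_cycle m0 fm0 d0].
have [eta eta0 Heta] := separated_seq sep.
have nesc x : escaping f r0 x -> x \notin post_crit.
  move=> ex; apply/negP => xP; have := Heta x x ex xP.
  by rewrite subrr cmod0 leNgt eta0.
have small x : x \in post_crit -> cmod x < r0.
  move=> xP; rewrite ltNge; apply/negP => h.
  by have := nesc x; rewrite xP => /(_ (ex_intro _ 0%N h)).
pose Cs := \sum_(x <- post_crit) cmod (residue x).
have Cs0 : 0 <= Cs by apply: sumr_ge0 => x _; exact: cmod_ge0.
have far z x : r0 + 1 <= cmod z -> x \in post_crit -> 1 <= cmod (z - x).
  by move=> hz /small; have := cmodB_ge z x; lra.
have q0' : 0 < cmod (q z0) by rewrite cmod_gt0.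
(* The poles have modulus less than [r0]; the margin 4 keeps the disk of radius
   [r <= 1] around [z0] at distance at least 1 from them, with [3 * r < |z0|]. *)
pose r := Num.min 1 (cmod (q z0) / (2 * (Cs + 1))).
have den0 : 0 < 2 * (Cs + 1) by rewrite mulr_gt0 // ltr_wpDl.
have r_gt0 : 0 < r by rewrite lt_min ltr01 divr_gt0.
have r1 : r <= 1 by rewrite ge_min lexx.
have rCs : Cs * r <= cmod (q z0) / 2.
  have : r <= cmod (q z0) / (2 * (Cs + 1)) by rewrite ge_min lexx orbT.
  rewrite ler_pdivlMr // => h; rewrite ler_pdivlMr //; nra.
have near z : cmod (z - z0) <= r -> r0 + 1 <= cmod z.
  by move=> hz; have := cmod_triangle z0 0 z; rewrite !subr0 cmodBC; lra.
pose m1 := Num.min 1 (cmod K * (Num.min 1 eta) ^+ (k0 + k1)).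
have eta1 : 0 < Num.min 1 eta by rewrite lt_min ltr01.
have m1_gt0 : 0 < m1 by rewrite lt_min ltr01 mulr_gt0 ?cmod_gt0 ?exprn_gt0.
have df_ge u : escaping f r0 u -> m1 <= cmod f^`().[u].
  move=> eu; rewrite ge_min; apply/orP; right.
  rewrite df !(hornerZ, hornerM, hornerXn, horner_exp) -polyC1 hornerXsubC !cmodM !cmodX.
  rewrite ler_wpM2l ?cmod_ge0 // exprD.
  have h0 : Num.min 1 eta <= cmod u.
    rewrite -[u]subr0 ge_min (Heta u 0 eu) ?orbT //; exact: orbit0_post_crit 0%N.
  have h1 : Num.min 1 eta <= cmod (u - 1).
    rewrite ge_min (Heta u 1 eu) ?orbT //; exact: orbit1_post_crit 0%N.
  by rewrite ler_pM ?exprn_ge0 ?(ltW eta1) // lerXn2r ?nnegrE ?cmod_ge0 ?(ltW eta1).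
have [V [VE V0 V1 szV]] := critical_value_quotient K0 k0_gt0 k1_gt0 df.
have szf := size_two_crit_gt2 K0 k0_gt0 df.
apply: (@no_invariant_density R f r0 esc q (Cs / eta + 1) m1 _ _ _ _ _ _ z0 r
   (cmod (q z0) / 2)) => //.
- by rewrite ltr_wpDl // divr_ge0 // ltW.
- move=> u eu; rewrite quad_simple_fractions.
  apply: le_trans (_ : Cs / eta <= _); last by rewrite lerDl.
  by apply: cmod_simple_fractions => // x xP; exact: Heta.
- by rewrite ge_min lexx.
- move=> z ez.
  have szfz : size (f - z%:P) = size f.
    rewrite size_polyDl // size_polyN (leq_ltn_trans (size_polyC_leq1 _)) //.
    exact: ltnW szf.
  have ru u : root (f - z%:P) u = (f.[u] == z) by rewrite rootE !hornerE subr_eq0.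
  have pre u : f.[u] = z -> escaping f r0 u.
    by move=> fu; apply: (@escaping_preimage _ _ _ 1); rewrite /= fu.
  have [|u|us [uus rus sus]] := @simple_roots_seq _ (f - z%:P).
  + by rewrite -size_poly_gt0 szfz; exact: leq_trans szf.
  + rewrite ru derivB derivC subr0 => /eqP /pre /df_ge h.
    by rewrite -cmod_gt0 (lt_le_trans m1_gt0).
  have fus u : u \in us -> f.[u] = z by move=> /(allP rus); rewrite ru => /eqP.
  exists us; split => //.
  apply: (quad_pushforward n0 m0 fn1 fm0 VE V0 V1 szV) => //; rewrite -?szfz //.
  + by rewrite szfz; exact: ltnW.
  + move=> i; have := nesc z ez.
    by split; apply: contraNneq H => <-; [exact: orbit1_post_crit|exact: orbit0_post_crit].
  + by move=> u /fus /pre /df_ge h; rewrite -cmod_gt0 (lt_le_trans m1_gt0).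
- by rewrite divr_gt0.
- lra.
- lra.
- move=> z hz; rewrite quad_simple_fractions.
  have := @simple_fractions_lipschitz _ post_crit residue z0 z.
  rewrite -!quad_simple_fractions -/Cs (cmodBC z0 z) => h.
  have {}h := h (fun x => far z0 x _) (fun x => far z x (near z hz)).
  have {}h : cmod (q z0 - q z) <= Cs * cmod (z - z0) by apply: h; lra.
  have : Cs * cmod (z - z0) <= Cs * r by rewrite ler_wpM2l.
  have := cmodD (q z0 - q z) (q z); rewrite subrK; lra.
Qed.

(** The residues of [q] at 1 and 0 are [lam] and [mu]: a point of an orbit
    that is critical but not the last one has weight 0. *)
Theorem critical_rigidity : lam = 0 /\ mu = 0.
Proof.
have d0 := deriv_at0 k0_gt0 df; have d1 := deriv_at1 k1_gt0 df.
have [r0 r0_ge1 esc] := escape_radius (size_two_crit_gt2 K0 k0_gt0 df).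
have res0 : {in post_crit, forall x, residue x = 0}.
  apply: (@simple_fractions_inj _ post_crit residue (undup_uniq _)
    (\sum_(x <- post_crit) cmod x + r0 + 4)) => [x xP|z hz].
    rewrite -addrA ltr_pwDr //; first by lra.
    rewrite (bigD1_seq x) ?undup_uniq //= lerDl sumr_ge0 // => y _; exact: cmod_ge0.
  rewrite -quad_simple_fractions.
  apply: (quad_vanishes_at_infinity r0_ge1 esc); apply: le_trans hz.
  by rewrite -addrA lerDr sumr_ge0 // => y _; exact: cmod_ge0.
have last_sum x c k : (0 < k)%N -> f^`().[c] = 0 ->
    orbit_sum f x k (fun y => (y == c)%:R) = (it f k x == c)%:R.
  move=> k_gt0 dc; rewrite orbit_sum_last // => w.
  by case: eqP => [->|_]; rewrite ?dc ?mul0r ?mulr0.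
have r1 := res0 1 (orbit1_post_crit 0); have r2 := res0 0 (orbit0_post_crit 0).
move: r1 r2; rewrite /residue /pc_sum !last_sum // fn1 fm0 !eqxx.
by rewrite eq_sym oner_eq0 !mulr1 !mulr0 add0r addr0.
Qed.

End CriticalRigidity.

(** * The Jacobian determinant *)

Section Jacobian.
Variables (F : fieldType) (d k : nat) (a c : F).
Local Notation B := (Bpoly F d k).
Local Notation f := (a *: B + c%:P).
Local Notation ac := (fun l : 'I_2 => if l == 0 then a else c).
Local Notation lift p := (map_poly (@mpolyC 2 F) p).

Lemma meval_lift (p : {poly F}) z : meval ac (lift p).[z] = p.[meval ac z].
Proof.
rewrite -horner_map -map_poly_comp /=; congr (_.[_]).
by rewrite (@eq_map_poly _ _ _ id) ?map_poly_id // => x /=; rewrite mevalC.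
Qed.

Lemma mderiv_lift (p : {poly F}) z j :
  mderiv j (lift p).[z] = (lift p^`()).[z] * mderiv j z.
Proof.
elim/poly_ind: p => [|p b IH].
  by rewrite deriv0 map_poly0 horner0 raddf0 mul0r.
rewrite derivMXaddC !rmorphD !rmorphM /= !map_polyX map_polyC /=.
rewrite !hornerD !hornerM !hornerX hornerC mderivD mderivM mderivC IH; ring.
Qed.

Lemma meval_univ_map n z :
  meval ac (iter n (univ_map d k) z) = it f n (meval ac z).
Proof.
elim: n => //= n <-; rewrite /univ_map rmorphD rmorphM /= meval_lift.
by rewrite !mevalXU /= hornerD hornerZ hornerC.
Qed.

Lemma mderiv_var (i j : 'I_2) :
  mderiv j (mpolyX F (mnm1 i)) = (j == i)%:R.
Proof.
rewrite mderivX mnm1E eq_sym; case: eqP => [->|_]; last by rewrite scale0r.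
by rewrite scale1r -{1}[mnm1 i]add0m addmK mpolyX0.
Qed.

(** The partial derivatives of [a B(x) + c] with respect to [a] and [c],
    written as functions of the image point [y = a B(x) + c]. *)
Definition param_deriv (j : 'I_2) (y : F) : F := if j == 0 then (y - c) / a else 1.

Lemma mderiv_univ_map n z j : a != 0 -> mderiv j z = 0 ->
  meval ac (mderiv j (iter n (univ_map d k) z)) =
    orbit_sum f (meval ac z) n (param_deriv j).
Proof.
move=> a0 z0; elim: n => [|n IH]; first by rewrite /= z0 raddf0.
rewrite iterS orbit_sumS -IH -meval_univ_map; set w := iter n _ z.
rewrite -meval_univ_map iterS -/w /univ_map mderivD mderivM !rmorphD !rmorphM /=.
rewrite mderiv_lift rmorphM /= !meval_lift derivD derivZ derivC addr0 hornerZ.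
rewrite !mevalXU /= /param_deriv.
rewrite /var_a /var_c !mderiv_var.
have -> : (j == 1) = (j != 0) by move: j {z0 IH} => [[|[|?]] ?].
case: (j == 0) => /=; rewrite ?rmorph1 ?rmorph0; last by ring.
by field.
Qed.

End Jacobian.

Lemma det_mx2 (F : comNzRingType) (A : 'M[F]_2) :
  \det A = A 0 0 * A 1 1 - A 0 1 * A 1 0.
Proof.
rewrite (expand_det_row _ 0) !big_ord_recl big_ord0 addr0 /cofactor !det_mx11 !mxE /=.
rewrite expr0 mul1r expr1 mulN1r mulrN.
by congr (_ * _ - _ * _); congr (A _ _); apply: val_inj.
Qed.

Section Transversality.
Variables (R : realType) (d k : nat) (a c K : R[i]%C) (k0 k1 n m : nat).
Local Notation C := R[i]%C.
Local Notation f := (a *: Bpoly C d k + c%:P).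
Hypotheses (a0 : a != 0) (K0 : K != 0).
Hypotheses (k0_gt0 : (0 < k0)%N) (k1_gt0 : (0 < k1)%N).
Hypothesis dB : (Bpoly C d k)^`() = K *: ('X ^+ k0 * ('X - 1) ^+ k1).
Hypotheses (n0 : (0 < n)%N) (m0 : (0 < m)%N).
Hypotheses (fn1 : it f n 1 = 1) (fm0 : it f m 0 = 0).

(** A vanishing determinant makes [(q 1, - p 1)] and [(q 0, - p 0)] elements of
    the kernel of the transposed matrix. By rigidity both are zero; but then
    the matrix is zero, and [(1, 0)] is a kernel element too. *)
Theorem jacobian_det_neq0 :
  jacobian_det (eq_C0 C d k n) (eq_C1 C d k m) a c != 0.
Proof.
pose p j := orbit_sum f 1 n (param_deriv a c j).
pose q j := orbit_sum f 0 m (param_deriv a c j).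
have df : f^`() = (a * K) *: ('X ^+ k0 * ('X - 1) ^+ k1).
  by rewrite derivD derivZ derivC addr0 dB scalerA.
have rigid lam mu : lam * p 0 + mu * q 0 = 0 -> lam * p 1 + mu * q 1 = 0 ->
    lam = 0 /\ mu = 0.
  move=> e0 e1; apply: (critical_rigidity (mulf_neq0 a0 K0) k0_gt0 k1_gt0 df
    n0 m0 fn1 fm0) => //.
  transitivity (a * pc_sum f n m lam mu (param_deriv a c 0) +
    c * pc_sum f n m lam mu (param_deriv a c 1)); last first.
    by rewrite [X in a * X]e0 [X in c * X]e1 !mulr0 addr0.
  rewrite -!pc_sumZ -pc_sumD.
  by apply: eq_pc_sum => i; rewrite /param_deriv /=; field.
have -> : jacobian_det (eq_C0 C d k n) (eq_C1 C d k m) a c =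
    p 0 * q 1 - p 1 * q 0.
  have P j : meval (fun l : 'I_2 => if l == 0 then a else c)
      (mderiv j (eq_C0 C d k n)) = p j.
    rewrite /eq_C0 mderivB mderivC subr0 mderiv_univ_map // ?rmorph1 //.
    by rewrite -[1]/(mpolyC _ 1) mderivC.
  have Q j : meval (fun l : 'I_2 => if l == 0 then a else c)
      (mderiv j (eq_C1 C d k m)) = q j.
    by rewrite /eq_C1 mderiv_univ_map // ?rmorph0 // raddf0.
  by rewrite /jacobian_det det_mx2 !mxE /= !P !Q.
apply/negP => /eqP det0.
have [q1 p1] : q 1 = 0 /\ - p 1 = 0.
  by apply: rigid; [rewrite mulNr [p 1 * _]mulrC -det0; ring|ring].
have [q0 p0] : q 0 = 0 /\ - p 0 = 0.
  by apply: rigid; [ring|rewrite -[RHS]oppr0 -det0; ring].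
have [/eqP] : (1 : C) = 0 /\ (1 : C) = 0; last by rewrite oner_eq0.
apply: rigid; rewrite ?q0 ?q1 mul1r mulr0 addr0; apply/eqP.
  by rewrite -oppr_eq0 p0.
by rewrite -oppr_eq0 p1.
Qed.

End Transversality.

(** * Affine conjugation and the normal form *)

Section AffineConjugation.
Variable F : fieldType.
Implicit Types (u v z : F) (T : marked_poly F).

Lemma horner_affine u v z : (affine u v).[z] = u * z + v.
Proof. by rewrite /affine !hornerE. Qed.

Lemma affine_invK u v z : u != 0 -> (affine u v).[(affine_inv u v).[z]] = z.
Proof. by move=> u0; rewrite !horner_affine; field. Qed.

Lemma comp_affine u v u' v' :
  affine u v \Po affine u' v' = affine (u * u') (u * v' + v).
Proof.
rewrite {1}/affine comp_polyD comp_polyZ comp_polyX comp_polyC /affine.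
by rewrite scalerDr scalerA scale_polyC polyCD addrA.
Qed.

Lemma comp_affine_inv u v u' v' : u != 0 -> u' != 0 ->
  affine_inv u' v' \Po affine_inv u v = affine_inv (u * u') (u * v' + v).
Proof.
move=> u0 u'0; rewrite /affine_inv comp_affine.
by congr affine; field; rewrite ?u0 ?u'0.
Qed.

Lemma conj_affine_comp u v u' v' T : u != 0 -> u' != 0 ->
  conj_affine u' v' (conj_affine u v T) = conj_affine (u * u') (u * v' + v) T.
Proof.
move=> u0 u'0; rewrite /conj_affine /= -comp_affine_inv // -comp_affine.
by rewrite !comp_polyA !horner_comp.
Qed.

Lemma affine_id : affine 1 0 = 'X :> {poly F}.
Proof. by rewrite /affine scale1r addr0. Qed.

Lemma conj_affine_id T : conj_affine 1 0 T = T.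
Proof.
rewrite /conj_affine /affine_inv invr1 mul0r oppr0 affine_id.
by rewrite comp_polyX comp_polyXr !hornerX; case: T.
Qed.

Lemma affine_equiv_sym T T' : affine_equiv T T' -> affine_equiv T' T.
Proof.
case=> u [v [u0 ->]]; exists u^-1, (- (v / u)); split; first by rewrite invr_eq0.
rewrite conj_affine_comp ?invr_eq0 // mulfV // mulrN mulrC divfK // addNr.
by rewrite conj_affine_id.
Qed.

Lemma affine_equiv_trans T T' T'' :
  affine_equiv T T' -> affine_equiv T' T'' -> affine_equiv T T''.
Proof.
case=> u [v [u0 ->]] [u' [v' [u'0 ->]]].
exists (u * u'), (u * v' + v); split; first exact: mulf_neq0.
exact: conj_affine_comp.
Qed.

Lemma eq_class_affine_equiv T T' : affine_equiv T T' -> eq_class T = eq_class T'.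
Proof.
move=> TT'; apply/seteqP; split=> T'' /=; apply: affine_equiv_trans => //.
exact: affine_equiv_sym.
Qed.

Lemma iter_conj_affine u v T n z : u != 0 ->
  it (mp_poly (conj_affine u v T)) n (affine_inv u v).[z] =
  (affine_inv u v).[it (mp_poly T) n z].
Proof. by move=> u0; elim: n => //= n ->; rewrite !horner_comp affine_invK. Qed.

(** Stated for any marked point [pt] that moves with the conjugation, so as to
    serve for both critical points. *)
Lemma eq_class_periodic n (pt : marked_poly F -> F) T T' :
    (forall u v S, pt (conj_affine u v S) = (affine_inv u v).[pt S]) ->
    eq_class T T' ->
    it (mp_poly T') n (pt T') = pt T' -> it (mp_poly T) n (pt T) = pt T.
Proof.
move=> ptE [u [v [u0 ->]]]; rewrite ptE iter_conj_affine // => h.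
by rewrite -[LHS](affine_invK v _ u0) h affine_invK.
Qed.

End AffineConjugation.

Section NormalForm.
Variable F : numFieldType.

Lemma bin_div_fact k i : (i <= k)%N ->
  ((k - i)`! * i`!)%:R^-1 = 'C(k, i)%:R / (k`!)%:R :> F.
Proof.
move=> ik; have := bin_fact ik; rewrite mulnC => <-; rewrite mulnC !natrM.
by field; rewrite !pnatr_eq0 -!lt0n !fact_gt0 bin_gt0 ik.
Qed.

(** The factor [d - i] that differentiation brings out completes the product
    over [j != i], so that up to a constant the coefficients become those of
    the binomial expansion of [(1 - X)^k]. *)
Lemma deriv_Bpoly d k : (k < d)%N ->
  (Bpoly F d k)^`() =
    ((-1) ^+ k * (\prod_(j < k.+1) (d - j)%:R / (k`!)%:R)) *:
      ('X ^+ (d - 1 - k) * ('X - 1) ^+ k).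
Proof.
move=> kd; set D := \prod_(j < k.+1) _.
have -> : ('X - 1 : {poly F}) = (-1) *: (- 'X + 1) by rewrite scaleN1r opprD opprK.
rewrite exprZn exprDn -scalerAr scalerA mulrAC -expr2 sqrr_sign mul1r.
rewrite mulr_sumr scaler_sumr /Bpoly raddf_sum; apply: eq_bigr => i _ /=.
have ik : (i <= k)%N by rewrite -ltnS.
rewrite derivZ derivXn expr1n mulr1 -scaleN1r exprZn -scaler_nat.
rewrite mulrnAr -scalerAr -exprD -scaler_nat !scalerA.
have -> : (d - 1 - k + (k - i))%N = (d - i).-1 by lia.
congr (_ *: _); rewrite bin_div_fact //.
have -> : D = (d - i)%:R * \prod_(j < k.+1 | j != i) (d - j)%:R.
  by rewrite /D (bigD1 i).
by move: (\prod_(_ < _ | _) _) (d - i)%:R => A b; ring.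
Qed.

Lemma deriv_Bpoly_coef_neq0 d k : (k < d)%N ->
  (-1) ^+ k * (\prod_(j < k.+1) (d - j)%:R / (k`!)%:R) != 0 :> F.
Proof.
move=> kd; rewrite mulf_neq0 ?signr_eq0 // mulf_neq0 ?invr_eq0 ?pnatr_eq0 -?lt0n ?fact_gt0 //.
apply/prodf_neq0 => j _; rewrite pnatr_eq0 -lt0n subn_gt0.
by apply: leq_ltn_trans kd; rewrite -ltnS.
Qed.

Lemma crit_tuple_deriv d k (T : marked_poly F) : (k < d)%N -> crit_tuple d k T ->
  exists2 K : F, K != 0 & (mp_poly T)^`() =
    K *: (('X - (mp_c1 T)%:P) ^+ k * ('X - (mp_c2 T)%:P) ^+ (d - 1 - k)).
Proof.
case: T => P c1 c2 /= kd [/= sP c12 _ m1 m2].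
have sP' : size P^`() = d by rewrite size_deriv0 sP.
have P0 : P^`() != 0 by rewrite -size_poly_gt0 sP' (leq_ltn_trans _ kd).
set Q := (_ * _ : {poly F}).
have sQ : size Q = d.
  rewrite size_mul ?expf_neq0 ?polyXsubC_eq0 // !size_exp_XsubC; lia.
have QP : Q %| P^`().
  rewrite Gauss_dvdp; last first.
    by rewrite coprimep_expl // coprimep_expr // coprimep_XsubC rootE hornerXsubC subr_eq0 eq_sym.
  by rewrite -!mup_geq // m1 m2 !leqnn.
have : Q %= P^`() by rewrite -dvdp_size_eqp // sQ sP'.
rewrite eqp_sym => /eqpf_eq[K K0 E]; exists K => //.
Qed.

(** Conjugating by the affine map that sends 1 to [c1] and 0 to [c2] gives a
    polynomial whose derivative is proportional to that of [Bpoly]; the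
    quotient of the two constants is [a]. *)
Theorem crit_tuple_normal_form d k (T : marked_poly F) : (k < d)%N -> crit_tuple d k T ->
  exists a c : F, a != 0 /\
    affine_equiv T (MarkedPoly (a *: Bpoly F d k + c%:P) 1 0).
Proof.
move=> kd HT; have [K K0 dP] := crit_tuple_deriv kd HT.
case: HT => _ c12 _ _ _; case: T c12 dP => P c1 c2 /= c12 dP.
pose u := c1 - c2; have u0 : u != 0 by rewrite subr_eq0.
pose g := affine_inv u c2 \Po (P \Po affine u c2).
have dg : g^`() = (K * u ^+ k * u ^+ (d - 1 - k)) *: ('X ^+ (d - 1 - k) * ('X - 1) ^+ k).
  rewrite /g deriv_comp deriv_comp.
  have da (b e : F) : (affine b e)^`() = b%:P.
    by rewrite /affine derivD derivZ derivX derivC addr0 alg_polyC.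
  rewrite /affine_inv !da comp_polyC mulrCA -polyCM mulVf // mulr1 dP.
  rewrite comp_polyZ comp_polyM !rmorphXn /= !comp_polyB !comp_polyX !comp_polyC.
  have -> : affine u c2 - c1%:P = u *: ('X - 1).
    rewrite /affine scalerBr -addrA -polyCB -[c2 - c1]opprB -/u polyCN.
    by rewrite -alg_polyC.
  have -> : affine u c2 - c2%:P = u *: 'X by rewrite /affine addrK.
  rewrite !exprZn -scalerAl -scalerAr !scalerA; congr (_ *: _); exact: mulrC.
pose KB := (-1) ^+ k * (\prod_(j < k.+1) (d - j)%:R / (k`!)%:R) : F.
have KB0 : KB != 0 := deriv_Bpoly_coef_neq0 kd.
pose a := K * u ^+ k * u ^+ (d - 1 - k) / KB.
have a0 : a != 0 by rewrite mulf_neq0 ?invr_eq0 // !mulf_neq0 ?expf_neq0.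
have dgB : (g - a *: Bpoly F d k)^`() = 0.
  by rewrite derivB derivZ dg deriv_Bpoly // scalerA -/KB /a divfK // subrr.
exists a, (g - a *: Bpoly F d k).[0]; split => //.
exists u, c2; split => //; rewrite /conj_affine /=.
rewrite -(deriv_eq0 dgB) [_ + (g - _)]addrC subrK -/g.
congr MarkedPoly; rewrite horner_affine; last by field.
by rewrite /u; field.
Qed.

End NormalForm.

Theorem theorem1 (R : realType) :
  exists S : seq (nat * nat),
    forall d k : nat,
      (3 <= d)%N -> (1 <= k)%N -> (k <= d - 2)%N -> (d, k) \notin S ->
      forall n m : nat, (1 <= n)%N -> (1 <= m)%N ->
        intersect_transversely R[i]%C d k n m.
Proof.
exists [::] => d k d3 k1 kd _ n m n1 m1 X [[T HT ->] [T1 TT1 per1]].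
move=> [_ [T2 TT2 per2]].
have kd' : (k < d)%N by lia.
have [a [c [a0 eqv]]] := crit_tuple_normal_form kd' HT.
exists a, c; split => //; first exact: eq_class_affine_equiv.
rewrite (eq_class_affine_equiv eqv) in TT1 TT2.
have fn1 := eq_class_periodic (pt := @mp_c1 _) (fun _ _ _ => erefl) TT1 per1.
have fm0 := eq_class_periodic (pt := @mp_c2 _) (fun _ _ _ => erefl) TT2 per2.
apply: (jacobian_det_neq0 a0 (deriv_Bpoly_coef_neq0 _ kd') _ k1 (deriv_Bpoly _ kd')) => //.
by lia.
Qed.
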